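(* For any odd positive integer $p\ge 3$, the strongly invertible pretzel knot $K=P(-p,p,-p)$ has equivariant Rasmussen invariant $$(\underline{s}(K),\overline{s}(K))=(0,2).$$
   Context: The knot. $P(-p,p,-p)$ is the pretzel knot with its standard planar diagram of three vertical columns of $p$ crossings (half-twists) each; the strands are antiparallel in each column, the crossings in the two outer columns are positive and those in the central column are negative. Its strong inversion $\tau$ is the $180$-degree rotation about the vertical axis in the projection plane passing through all crossings of the central column (it interchanges the outer columns and reverses the orientation of $K$). Equivariant Rasmussen invariant. Let $R=\mathbb F_2[h]$, $\deg h=-2$, and $A=R[X]/(X^2-hX)$ the Frobenius algebra with counit $\epsilon(1)=0,\ \epsilon(X)=1$; put $Y=X-h$ (so $XY=0$, $\Delta X=X\otimes X$, $\Delta Y=Y\otimes Y$). A strongly invertible link diagram $L$ is an oriented link diagram invariant under the $180$-degree rotation $\tau$ about the $y$-axis in the plane (reflection $(x,y)\mapsto(-x,y)$ with over/under exchanged), with $\tau$ reversing the orientation of $L$. Let $\mathrm{CKh}(L)$ be the Khovanov complex of $L$ over $R$ defined by $A$ (bigraded Bar-Natan homology). $\tau$ acts on the resolutions of $L$, sending a circle $C$ of a resolution $L_v$ to the circle $\tau C$ of $\tau L_v$, and so induces a chain involution $\tau$ on $\mathrm{CKh}(L)$ transporting labels. The involutive Khovanov complex is $\mathrm{CKhI}(L)=\mathrm{Cone}(\mathrm{CKh}(L)\xrightarrow{1-\tau}\mathrm{CKh}(L))$, with underlying module $\mathrm{CKh}(L)\oplus\mathrm{CKh}(L)[1]$, where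 the second copy has its homological degree raised by $1$. Lee cycle: take the Seifert (orientation-preserving) resolution of $L$, color the regions of its complement in checkerboard fashion with the unbounded region white, and label each Seifert circle by $X$ if it has a black region on its left and by $Y$ otherwise; this labelled resolution is the Lee cycle $\alpha(L)\in\mathrm{CKh}^0(L)$. It is $\tau$-invariant, so its two copies $\underline\alpha(L)\in\mathrm{CKhI}^0(L)$ and $\overline\alpha(L)\in\mathrm{CKhI}^1(L)$ (in the first and second summand, respectively) are cycles. For a cycle $z$ with class $[z]$ in homology $H$, let $d_h([z])$ be the largest $k\ge0$ such that the image of $[z]$ in $H/\mathrm{Tor}(H)$ lies in $h^k(H/\mathrm{Tor}(H))$. Put $\underline d_h(L)=d_h([\underline\alpha(L)])$ and $\overline d_h(L)=d_h([\overline\alpha(L)])$. With $w(L)$ the writhe and $r(L)$ the number of Seifert circles of $L$, $$\underline s(L)=2\underline d_h(L)+w(L)-r(L)+1,\qquad \overline s(L)=2\overline d_h(L)+w(L)-r(L)+1,$$ which are invariants of the strongly invertible link. *)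

(* Defs.v *)
From HB Require Import structures.
From mathcomp Require Import all_boot all_order all_algebra.

Set Implicit Arguments.
Unset Strict Implicit.
Unset Printing Implicit Defensive.

Import GRing.Theory.
Local Open Scope ring_scope.

(* A crossing has four half-edges ("darts"), numbered counterclockwise by
   'Z_4.  The dart (c, i) also names the corner at c lying between the darts
   (c, i) and (c, i + 1). *)
Definition rot {C : finType} (d : C * 'Z_4) : C * 'Z_4 := (d.1, d.2 + 1).
Definition rotV {C : finType} (d : C * 'Z_4) : C * 'Z_4 := (d.1, d.2 - 1).

Lemma rotK (C : finType) : cancel (@rot C) rotV.
Proof. by case=> c i; rewrite /rot /rotV /= addrK. Qed.

Lemma rotVK (C : finType) : cancel (@rotV C) rot.
Proof. by case=> c i; rewrite /rot /rotV /= subrK. Qed.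

Lemma rot4 (C : finType) (d : C * 'Z_4) : rot (rot d) = rotV (rotV d).
Proof.
by case: d => c i; congr (_, _); case: i => [[|[|[|[|]]]]] // ?; apply/val_inj.
Qed.

(* An oriented planar diagram of a nonsplit link with at least one crossing,
   up to planar isotopy, is encoded by the cyclic order of the darts at the
   crossings, the pairing dg_edge of the darts into edges and the choice of
   the unbounded region.  dg_out d says that the strand through d leaves the
   crossing at d.  A corner is to the left of the dart of the same name as
   seen from the crossing, so "rotV \o dg_edge" sends a corner to the next one
   of the same region and its orbits are the regions of the complement of the
   diagram; dg_euler is Euler's formula V - E + F = 2, with E = 2 V. *)
Record diagram := Diagram {
  dg_crossing : finType;
  dg_edge : dg_crossing * 'Z_4 -> dg_crossing * 'Z_4;
  dg_over : pred (dg_crossing * 'Z_4);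
  dg_out : pred (dg_crossing * 'Z_4);
  dg_inf : dg_crossing * 'Z_4;
  dg_edgeK : involutive dg_edge;
  dg_edge_neq : forall d, dg_edge d != d;
  dg_over_rot : forall d, dg_over (rot d) = ~~ dg_over d;
  dg_out_edge : forall d, dg_out (dg_edge d) = ~~ dg_out d;
  dg_out_opp : forall d, dg_out (rot (rot d)) = ~~ dg_out d;
  dg_connected : forall d d',
    connect [rel x y | (y == dg_edge x) || (y == rot x)] d d';
  dg_euler : fcard (rotV \o dg_edge) {: dg_crossing * 'Z_4}
             = (#|dg_crossing| + 2)%N
}.

Definition dart (L : diagram) : finType := (dg_crossing L * 'Z_4)%type.

Definition face (L : diagram) (d : dart L) : dart L := rotV (dg_edge d).

(* The 180-degree rotation about the vertical axis acts on the plane by a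
   reflection, hence inverts rot and sends the corner d to the corner
   rotV (si_tau d). *)
Record si_diagram := SIDiagram {
  si_diag :> diagram;
  si_tau : dart si_diag -> dart si_diag;
  si_tauK : involutive si_tau;
  si_tau_rot : forall d, si_tau (rot d) = rotV (si_tau d);
  si_tau_edge : forall d, si_tau (dg_edge d) = dg_edge (si_tau d);
  si_tau_over : forall d, dg_over (si_tau d) = ~~ dg_over d;
  si_tau_out : forall d, dg_out (si_tau d) = ~~ dg_out d;
  si_tau_inf : fconnect (@face si_diag) (dg_inf si_diag)
                        (rotV (si_tau (dg_inf si_diag)))
}.

Definition si_tauC (L : si_diagram) (c : dg_crossing L) : dg_crossing L :=
  (si_tau (c, 0)).1.

Lemma si_tau_fst (L : si_diagram) (d : dart L) : (si_tau d).1 = si_tauC d.1.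
Proof.
have rot1 (e : dart L) : (si_tau (rot e)).1 = (si_tau e).1.
  by rewrite si_tau_rot.
have E j : (si_tau (d.1, j%:R)).1 = si_tauC d.1.
  by elim: j => [|j <-] //; rewrite -(rot1 (d.1, j%:R)) /rot /= mulrSr.
by rewrite -(E d.2) natr_Zp -surjective_pairing.
Qed.

Section Resolutions.
Variable L : diagram.

Definition vertex := {ffun dg_crossing L -> bool}.

(* The 0-smoothing joins each under dart to its counterclockwise successor
   and the 1-smoothing joins each under dart to its counterclockwise
   predecessor; smooth v d is the dart joined to d. *)
Definition smooth (v : vertex) (d : dart L) : dart L :=
  if dg_over d (+) v d.1 then rotV d else rot d.

Lemma smoothK v : involutive (smooth v).
Proof.
move=> d; rewrite /smooth.
have ov : dg_over (rotV d) = ~~ dg_over d.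
  by rewrite -{2}(rotVK d) dg_over_rot negbK.
by case E: (dg_over d (+) v d.1);
  rewrite /= ?ov ?dg_over_rot addNb E /= ?rotK ?rotVK.
Qed.

Definition circ_rel (v : vertex) : rel (dart L) :=
  [rel x y | (y == dg_edge x) || (y == smooth v x)].

Definition same_circle (v : vertex) : rel (dart L) := connect (circ_rel v).

(* The darts in "roots (circ_rel v)" are representatives of the circles. *)
Definition ncircles (v : vertex) : nat := n_comp (circ_rel v) {: dart L}.

(* At a positive crossing the outgoing under dart is the counterclockwise
   successor of the outgoing over dart. *)
Definition positive (c : dg_crossing L) : bool :=
  [exists i : 'Z_4, [&& dg_over (c, i), dg_out (c, i) & dg_out (rot (c, i))]].

Definition writhe : int := \sum_c (if positive c then 1 else - 1).

Definition seifert : vertex := [ffun c => ~~ positive c].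

Lemma seifert_out d : dg_out (smooth seifert d) = ~~ dg_out d.
Proof.
case: d => c i.
have oS := @dg_over_rot L; have uS := @dg_out_opp L.
pose q (k : nat) : dart L := (c, inord k : 'Z_4).
have rq k : (k < 3)%N -> rot (q k) = q k.+1.
  by move=> k3; congr (_, _); apply/val_inj; rewrite /= !inordK //; case: k k3
    => [|[|[|]]].
have rq3 : rot (q 3) = q 0%N.
  by congr (_, _); apply/val_inj; rewrite /= !inordK.
have o1 := oS (q 0%N); have o2 := oS (q 1%N); have o3 := oS (q 2).
have u2 := uS (q 0%N); have u3 := uS (q 1%N).
rewrite !rq // in o1 o2 o3 u2 u3.
have qE j : (c, j) = q (val j) by rewrite /q inord_val.
have pos : positive c = [|| [&& dg_over (q 0%N), dg_out (q 0%N) & dg_out (q 1%N)],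
    [&& dg_over (q 1%N), dg_out (q 1%N) & dg_out (q 2)],
    [&& dg_over (q 2), dg_out (q 2) & dg_out (q 3)] |
    [&& dg_over (q 3), dg_out (q 3) & dg_out (q 0%N)]].
  apply/existsP/or4P => [[[[|[|[|[|]]]] // j4]]|].
  - by rewrite qE rq //; constructor 1.
  - by rewrite qE rq //; constructor 2.
  - by rewrite qE rq //; constructor 3.
  - by rewrite qE rq3 //; constructor 4.
  have ex k : [&& dg_over (q k), dg_out (q k) & dg_out (rot (q k))] ->
      exists j : 'Z_4, [&& dg_over (c, j), dg_out (c, j) & dg_out (rot (c, j))].
    by exists (inord k).
  by case=> H; [apply: (ex 0%N)|apply: (ex 1%N)|apply: (ex 2)|apply: (ex 3)];
    rewrite ?rq3 // rq.
have V1 : rotV (q 1%N) = q 0%N by rewrite -(rq 0%N) // rotK.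
have V2 : rotV (q 2) = q 1%N by rewrite -(rq 1%N) // rotK.
have V3 : rotV (q 3) = q 2 by rewrite -(rq 2) // rotK.
have V0 : rotV (q 0%N) = q 3 by rewrite -rq3 rotK.
rewrite /smooth ffunE /= pos o3 o2 o1 u2 u3.
rewrite qE; case: i => [[|[|[|[|]]]] // i4] /=; rewrite ?rq3 ?rq ?(V0, V1, V2, V3) //.
all: rewrite ?o3 ?o2 ?o1.
all: by case: (dg_over (q 0%N)); case E0: (dg_out (q 0%N));
  case E1: (dg_out (q 1%N)); rewrite /= ?u2 ?u3 ?E0 ?E1.
Qed.

(* Smoothing a crossing merges the two opposite corners that are not cut off
   by the smoothing arcs, i.e. the corners d and d + 2 with smooth v d = d - 1;
   the two sides of the dart d are the corners d and d - 1. *)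
Definition checkerboard (v : vertex) (col : {ffun dart L -> bool}) : bool :=
  [&& [forall d, col (face d) == col d],
      [forall d, (smooth v d == rotV d) ==> (col (rot (rot d)) == col d)],
      [forall d, col (rotV d) == ~~ col d]
    & ~~ col (dg_inf L)].

(* The regions of the Seifert resolution, coloured with the unbounded region
   white; see blackE for uniqueness of the colouring. *)
Definition black (d : dart L) : bool :=
  [exists col, checkerboard seifert col && col d].

Lemma checkerboard_inj v v' col col' :
  checkerboard v col -> checkerboard v' col' -> col = col'.
Proof.
case/and4P=> /forallP cf _ /forallP cr ci.
case/and4P=> /forallP cf' _ /forallP cr' ci'.
have step (f : {ffun dart L -> bool}) (Hf : forall d, f (face d) == f d)
    (Hr : forall d, f (rotV d) == ~~ f d) d :
    (f (rot d) = ~~ f d) * (f (dg_edge d) = ~~ f d).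
  split; first by rewrite -{2}(rotK d) (eqP (Hr _)) negbK.
  by rewrite -(eqP (Hf d)) /face (eqP (Hr _)) negbK.
apply/ffunP=> d; have /connectP[q] := dg_connected (dg_inf L) d.
have : col (dg_inf L) = col' (dg_inf L) by rewrite (negPf ci) (negPf ci').
elim: q (dg_inf L) => [|y q IHq] x /= Ex; first by move=> _ ->.
case/andP=> xy; apply: IHq.
by case/orP: xy => /eqP->;
  rewrite !(step col cf cr, step col' cf' cr') Ex.
Qed.

Lemma blackE col : checkerboard seifert col -> black =1 col.
Proof.
move=> ccol d; apply/existsP/idP => [[col' /andP[H]]|Hd].
  by rewrite (checkerboard_inj H ccol).
by exists col; rewrite ccol.
Qed.

(* The corner on the left of the oriented strand at d. *)
Definition left_corner (d : dart L) : dart L := if dg_out d then d else rotV d.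

(* true stands for the label X, false for the label Y; by leeX_circle it only
   depends on the Seifert circle of d. *)
Definition leeX (d : dart L) : bool := black (left_corner d).

Lemma leeX_circle d d' : same_circle seifert d d' -> leeX d = leeX d'.
Proof.
case: (boolP [exists col, checkerboard seifert col]) => [/existsP[col H]|N].
  have bE := blackE H; case/and4P: H => /forallP cf /forallP cm /forallP cr _.
  have edge1 e : leeX (dg_edge e) = leeX e.
    have E f : dg_out f -> leeX (dg_edge f) = leeX f.
      by move=> o; rewrite /leeX /left_corner dg_out_edge o !bE (eqP (cf f)).
    case o: (dg_out e); first exact: E.
    by rewrite -{2}(dg_edgeK e) (E (dg_edge e)) // dg_out_edge o.
  have sm1 e : leeX (smooth seifert e) = leeX e.
    have E f : dg_out f -> leeX (smooth seifert f) = leeX f.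
      move=> o; rewrite /leeX /left_corner seifert_out o !bE /=.
      have := cm f; rewrite /smooth; case: ifP => _; last by rewrite rotK.
      by rewrite eqxx -rot4 => /eqP.
    case o: (dg_out e); first exact: E.
    by rewrite -{2}(smoothK seifert e) (E (smooth seifert e)) // seifert_out o.
  case/connectP=> q; elim: q d => [|y q IHq] d /=; first by move=> _ ->.
  case/andP=> dy /IHq H /H <-.
  by case/orP: dy => /eqP->; rewrite ?edge1 ?sm1.
have b0 e : black e = false.
  apply: contraNF N => /existsP[col /andP[H _]].
  by apply/existsP; exists col.
by move=> _; rewrite /leeX !b0.
Qed.

End Resolutions.

Definition R : idomainType := {poly 'F_2}.
Definition h : R := 'X.

(* A = R[X]/(X^2 - hX) is handled through its basis (1, X), encoded by
   (false, true).  mulA a b c is the coefficient of c in the product a b, and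
   comulA a b c the coefficient of b (x) c in
   Delta 1 = 1 (x) X + X (x) 1 - h 1 (x) 1,  Delta X = X (x) X,
   the comultiplication determined by the counit epsA, see frobeniusA. *)
Definition mulA (a b c : bool) : R :=
  if a && b then (if c then h else 0) else (c == a || b)%:R.
Definition comulA (a b c : bool) : R :=
  if a then (b && c)%:R else if b || c then (b (+) c)%:R else - h.
Definition epsA (a : bool) : R := a%:R.

Lemma frobeniusA (a b c : bool) :
  \sum_x comulA b x c * \sum_y mulA a x y * epsA y = mulA a b c.
Proof.
rewrite !big_bool /=.
by case: a b c => [] [] [] /=;
  rewrite /mulA /comulA /epsA /= ?(mulr1n, mulr0n, mulr0, mul0r, mulr1, mul1r,
    addr0, add0r, subrr, addrN, addNr, eqxx).
Qed.

Lemma counitA (a c : bool) : \sum_b comulA a b c * epsA b = (a == c)%:R.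
Proof.
rewrite !big_bool /=.
by case: a c => [] [] /=;
  rewrite /comulA /epsA /= ?(mulr1n, mulr0n, mulr0, mul0r, mulr1, mul1r,
    addr0, add0r).
Qed.

Section Khovanov.
Variable L : diagram.

(* A generator of the complex: a vertex v of the cube and a labelling of the
   circles of the resolution L_v by 1 (false) or X (true), i.e. a labelling of
   the darts that is constant on circles. *)
Definition labelling (v : vertex L) (l : {ffun dart L -> bool}) : bool :=
  [forall d, (l (dg_edge d) == l d) && (l (smooth v d) == l d)].

Definition gen : finType :=
  {s : vertex L * {ffun dart L -> bool} | labelling s.1 s.2}.

Definition CKh : lmodType R := {ffun gen -> R^o}.

Definition touches (v : vertex L) (c : dg_crossing L) (d : dart L) : bool :=
  [exists i : 'Z_4, same_circle v (c, i) d].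

(* The darts (c, 0) and (c, 2) lie on different arcs of either smoothing of c,
   so they distinguish the two circles which are merged or created. *)
Definition dcoef_at (c : dg_crossing L) (s t : gen) : R :=
  let: (v, l) := val s in let: (v', l') := val t in
  if [&& ~~ v c, v' == [ffun b => (b == c) || v b]
       & [forall d, touches v c d || (l' d == l d)]] then
    if same_circle v (c, 0) (c, 2%:R) then
      comulA (l (c, 0)) (l' (c, 0)) (l' (c, 2%:R))
    else mulA (l (c, 0)) (l (c, 2%:R)) (l' (c, 0))
  else 0.

(* No edge signs are needed in characteristic 2. *)
Definition dKh (x : CKh) : CKh :=
  [ffun t : gen => \sum_(s : gen) x s * \sum_c dcoef_at c s t].

(* Coefficients on the basis (1, X) of X and of Y = X - h. *)
Definition leecoef (isX l : bool) : R :=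
  if l then 1 else if isX then 0 else - h.

Definition lee : CKh :=
  [ffun s : gen => if (val s).1 == seifert L
    then \prod_(d | roots (circ_rel (seifert L)) d)
           leecoef (leeX d) ((val s).2 d)
    else 0].

End Khovanov.

Section Involution.
Variable L : si_diagram.

Definition tau_vertex (v : vertex L) : vertex L :=
  [ffun c => v (si_tauC c)].
Definition tau_label (l : {ffun dart L -> bool}) : {ffun dart L -> bool} :=
  [ffun d => l (si_tau d)].

Lemma tau_smooth v (d : dart L) :
  si_tau (smooth (tau_vertex v) d) = smooth v (si_tau d).
Proof.
have tauV (e : dart L) : si_tau (rotV e) = rot (si_tau e).
  by rewrite -{2}(rotVK e) si_tau_rot rotVK.
rewrite /smooth ffunE si_tau_over si_tau_fst addNb.
by case: (_ (+) _); rewrite /= ?si_tau_rot ?tauV.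
Qed.

Lemma tau_labelling v l : labelling v l -> labelling (tau_vertex v) (tau_label l).
Proof.
move/forallP=> H; apply/forallP=> d; rewrite !ffunE si_tau_edge tau_smooth.
exact: H.
Qed.

(* Since tau is an involution, it is its own inverse here: the circle tau C of
   tau L_v carries the label of C. *)
Definition tau_gen (s : gen L) : gen L :=
  Sub (tau_vertex (val s).1, tau_label (val s).2) (tau_labelling (valP s)).

Definition tauKh (x : CKh L) : CKh L := [ffun s : gen L => x (tau_gen s)].

Definition CKhI : lmodType R := (CKh L * CKh L)%type.

Definition dKhI (z : CKhI) : CKhI := (dKh z.1, (z.1 - tauKh z.1) - dKh z.2).

Definition lee_under : CKhI := (lee L, 0).
Definition lee_over : CKhI := (0, lee L).

End Involution.

Section Divisibility.
Variables (M : lmodType R) (d : M -> M).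

Definition is_cycle (z : M) : Prop := d z = 0.
Definition is_boundary (z : M) : Prop := exists b : M, z = d b.

(* H is the total homology of (M, d), the direct sum over all homological
   degrees; divisibility of a homogeneous class in H/Tor(H) is the same as in
   its own degree.
   torsion_class z: the class of z lies in Tor(H). *)
Definition torsion_class (z : M) : Prop :=
  exists2 a : R, a != 0 & is_boundary (a *: z).

(* The image of [z] in H/Tor(H) lies in h^k (H/Tor(H)). *)
Definition divisible (k : nat) (z : M) : Prop :=
  exists2 w : M, is_cycle w & torsion_class (z - h ^+ k *: w).

(* d_h([z]) = k *)
Definition is_dh (z : M) (k : nat) : Prop :=
  [/\ is_cycle z, divisible k z & forall k', divisible k' z -> (k' <= k)%N].

End Divisibility.

Definition rasmussen_of (L : diagram) (k : nat) : int :=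
  2 * k%:Z + writhe L - (ncircles (seifert L))%:Z + 1.

(* s_under L s and s_over L s say that the lower, resp. upper, invariant of L
   is s; as d_h is unique when it exists, so is s. *)
Definition s_under (L : si_diagram) (s : int) : Prop :=
  exists2 k, is_dh (@dKhI L) (lee_under L) k & s = rasmussen_of L k.
Definition s_over (L : si_diagram) (s : int) : Prop :=
  exists2 k, is_dh (@dKhI L) (lee_over L) k & s = rasmussen_of L k.

Lemma fcard_classify (T F : finType) (f : T -> T) (cl : T -> F) (rep : F -> T) :
  injective f -> (forall x, cl (f x) = cl x) -> cancel rep cl ->
  (forall x, fconnect f (rep (cl x)) x) -> fcard f {: T} = #|F|.
Proof.
move=> injf clf repK clC.
have clI x y : fconnect f x y -> cl x = cl y.
  by case/connectP=> q; elim: q x => [|z q IHq] x /=;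
    [move=> _ -> | case/andP=> /eqP<- /IHq H /H; rewrite clf].
have sC : connect_sym (frel f) by apply: fconnect_sym.
rewrite -(card_codom (can_inj repK)) /n_comp_mem.
have <- : #|[seq froot f x | x in codom rep]| = #|codom rep|.
  apply: card_in_image => _ _ /codomP[a ->] /codomP[b ->] /eqP.
  by rewrite (root_connect sC) => /clI; rewrite !repK => ->.
apply: eq_card => x; rewrite !inE andbT; apply/idP/imageP=> [/eqP rx|[y _ ->]].
  exists (rep (cl x)); first exact: codom_f.
  by apply/esym; rewrite -[RHS]rx; apply/eqP; rewrite (root_connect sC).
exact: roots_root.
Qed.

Section Pretzel.

(* The standard diagram of P(-p, p, -p).  The crossing (k, r) is the r-th one,
   from top to bottom, of the k-th column, from left to right; its darts 0, 1,
   2, 3 point to the north-east, north-west, south-west and south-east.  At the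
   top, the north-east end of each column is joined to the north-west end of
   the next one (cyclically: the last arc goes over the whole diagram), and
   similarly at the bottom. *)
Variables (p : nat) (p_gt0 : (0 < p)%N).

Definition pcrossing : finType := ('Z_3 * 'I_p)%type.
Definition pdart : finType := (pcrossing * 'Z_4)%type.

Definition row_top : 'I_p := Ordinal p_gt0.

Definition pedge (d : pdart) : pdart :=
  let: ((k, r), i) := d in
  match val i with
  | 0 => if val r == 0%N then ((k + 1, r), 1) else ((k, ord_pred r), 3%:R)
  | 1 => if val r == 0%N then ((k - 1, r), 0) else ((k, ord_pred r), 2%:R)
  | 2 => if (val r).+1 == p then ((k - 1, r), 3%:R) else ((k, ordS r), 1)
  | _ => if (val r).+1 == p then ((k + 1, r), 2%:R) else ((k, ordS r), 0)
  end.

(* The over strands run from north-west to south-east in the outer columns and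
   from north-east to south-west in the central one. *)
Definition pover (d : pdart) : bool := odd (val d.2) (+) (d.1.1 == 1).

(* The two strands of each column are antiparallel. *)
Definition pout (d : pdart) : bool :=
  (d.2 \in [:: 0; 3%:R]) (+) odd (val d.1.2).

(* The corner to the west of the left column. *)
Definition pinf : pdart := ((0, row_top), 1).

Definition ptau (d : pdart) : pdart := ((2%:R - d.1.1, d.1.2), 1 - d.2).

Lemma ordS_val (r : 'I_p) : (val r).+1 != p -> val (ordS r) = (val r).+1.
Proof. by move=> H; rewrite /= modn_small // ltn_neqAle H ltn_ord. Qed.

Lemma ord_pred_val (r : 'I_p) : val r != 0%N -> val (ord_pred r) = (val r).-1.
Proof.
case: r => [[|r] rp] //= _; rewrite modnDr modn_small //.
exact: ltnW.
Qed.

Lemma Z4P (P : 'Z_4 -> Prop) : P 0 -> P 1 -> P 2%:R -> P 3%:R -> forall i, P i.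
Proof.
move=> P0 P1 P2 P3 [[|[|[|[|]]]] // i4].
- by rewrite (_ : Ordinal _ = 0) //; apply/val_inj.
- by rewrite (_ : Ordinal _ = 1) //; apply/val_inj.
- by rewrite (_ : Ordinal _ = 2%:R) //; apply/val_inj.
- by rewrite (_ : Ordinal _ = 3%:R) //; apply/val_inj.
Qed.

Lemma pedgeK : involutive pedge.
Proof.
case=> [[k r] i]; elim/Z4P: i => /=.
- case: eqP => [r0|/eqP r0] /=; first by rewrite r0 /= addrK.
  have E := ord_pred_val r0; have r' : (0 < r)%N by rewrite lt0n.
  rewrite /= in E; rewrite /= E prednK // ltn_eqF //= ord_predK //.
- case: eqP => [r0|/eqP r0] /=; first by rewrite r0 /= subrK.
  have E := ord_pred_val r0; have r' : (0 < r)%N by rewrite lt0n.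
  rewrite /= in E; rewrite /= E prednK // ltn_eqF //= ord_predK //.
- case: eqP => [r0|/eqP r0] /=; first by rewrite r0 eqxx subrK.
  have E := ordS_val r0; rewrite /= in E; by rewrite /= E ordSK.
- case: eqP => [r0|/eqP r0] /=; first by rewrite r0 eqxx addrK.
  have E := ordS_val r0; rewrite /= in E; by rewrite /= E ordSK.
Qed.

Lemma pedge_neq d : pedge d != d.
Proof.
by case: d => [[k r] i]; elim/Z4P: i => /=; case: ifP => _;
  rewrite /eq_op /= andbF.
Qed.

Lemma pover_rot (d : pdart) : pover (rot d) = ~~ pover d.
Proof.
by case: d => [[k r] i]; rewrite /pover /=; elim/Z4P: i => //=; case: (k == 1).
Qed.

Lemma pout_opp (d : pdart) : pout (rot (rot d)) = ~~ pout d.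
Proof.
by case: d => [[k r] i]; rewrite /pout /=; elim/Z4P: i => //=; case: (odd r).
Qed.

Lemma pout_edge d : pout (pedge d) = ~~ pout d.
Proof.
case: d => [[k r] i]; rewrite /pout.
have EP := @ord_pred_val r; have ES := @ordS_val r; rewrite /= in EP ES.
elim/Z4P: i => /=; case: ifP => [_|/negbT r0] /=;
  rewrite ?(ES r0) ?(EP r0) //=; try by case: (odd r).
all: by case: (nat_of_ord r) r0 => //= n _; rewrite negbK.
Qed.

Lemma ptauK : involutive ptau.
Proof. by case=> [[k r] i]; rewrite /ptau /= !subKr. Qed.

Lemma ptau_rot (d : pdart) : ptau (rot d) = rotV (ptau d).
Proof. by case: d => [[k r] i]; rewrite /ptau /rot /rotV /= opprD addrA. Qed.

Lemma ptau_edge d : ptau (pedge d) = pedge (ptau d).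
Proof.
case: d => [[k r] i]; elim/Z4P: i => /=; case: ifP => _; rewrite /ptau /=;
  congr (_, _, _); rewrite ?opprD ?opprK ?addrA //; apply/val_inj => //.
Qed.

Lemma ptau_over d : pover (ptau d) = ~~ pover d.
Proof.
case: d => [[k r] i]; rewrite /pover /=.
have -> : (2%:R - k == 1) = (k == 1) by case: k => [[|[|[|]]]].
by elim/Z4P: i => /=; case: (k == 1).
Qed.

Lemma ptau_out d : pout (ptau d) = ~~ pout d.
Proof.
by case: d => [[k r] i]; rewrite /pout /=; elim/Z4P: i => /=; case: (odd r).
Qed.

Lemma row_bot_subproof : (p.-1 < p)%N. Proof. by rewrite prednK. Qed.
Definition row_bot : 'I_p := Ordinal row_bot_subproof.

Lemma row_topE (r : 'I_p) : (val r == 0%N) = (r == row_top).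
Proof. by []. Qed.

Lemma row_botE (r : 'I_p) : ((val r).+1 == p) = (r == row_bot).
Proof. by rewrite -[X in _.+1 == X]prednK // eqSS. Qed.

Lemma row_ind (P : 'I_p -> Prop) : P row_top ->
  (forall r, r != row_top -> P (ord_pred r) -> P r) -> forall r, P r.
Proof.
move=> P0 PS r; move En: (val r) => n; elim: n r En => [|n IHn] r En.
  by rewrite (_ : r = row_top) //; apply/val_inj.
have r0 : val r != 0%N by rewrite En.
by apply: PS => //; apply: IHn; rewrite ord_pred_val // En.
Qed.

Definition pface (d : pdart) : pdart := rotV (pedge d).

Lemma pfaceE k r :
  (pface ((k, r), 0) =
     if r == row_top then ((k + 1, r), 0) else ((k, ord_pred r), 2%:R)) *
  (pface ((k, r), 1) =
     if r == row_top then ((k - 1, r), 3%:R) else ((k, ord_pred r), 1)) *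
  (pface ((k, r), 2%:R) =
     if r == row_bot then ((k - 1, r), 2%:R) else ((k, ordS r), 0)) *
  (pface ((k, r), 3%:R) =
     if r == row_bot then ((k + 1, r), 1) else ((k, ordS r), 3%:R)).
Proof.
by do !split; rewrite /pface /pedge /rotV /= ?(row_topE, row_botE);
  case: ifP => _; congr (_, _); apply/val_inj.
Qed.

Lemma ordS_neq_top (r : 'I_p) : r != row_bot -> ordS r != row_top.
Proof. by rewrite -row_botE -row_topE => /ordS_val->. Qed.

Lemma ord_pred_neq_bot (r : 'I_p) : r != row_top -> ord_pred r != row_bot.
Proof.
rewrite -row_botE -row_topE => r0; rewrite ord_pred_val // prednK ?lt0n //.
by rewrite neq_ltn ltn_ord.
Qed.

Definition pcl (d : pdart) : option (option pcrossing) :=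
  let: ((k, r), i) := d in
  match val i with
  | 0 => if r == row_top then None else Some (Some (k, r))
  | 1 => Some (Some (k - 1, row_top))
  | 2 => if r == row_bot then Some None else Some (Some (k, ordS r))
  | _ => Some (Some (k, row_top))
  end.

Definition prep (x : option (option pcrossing)) : pdart :=
  match x with
  | None => ((0, row_top), 0)
  | Some None => ((0, row_bot), 2%:R)
  | Some (Some (k, r)) =>
    if r == row_top then ((k, row_top), 3%:R) else ((k, r), 0)
  end.

Lemma Z3P (P : 'Z_3 -> Prop) :
  P 0 -> (forall k, P k -> P (k + 1)) -> forall k, P k.
Proof.
move=> P0 PS k; rewrite -(natr_Zp k).
by elim: (nat_of_ord k) => [|n IHn]; [exact: P0 | rewrite mulrSr; apply: PS].
Qed.

Lemma pface_inj : injective pface.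
Proof. exact: inj_comp (can_inj (@rotVK _)) (inv_inj pedgeK). Qed.

Lemma pface_side k r :
  fconnect pface ((k, row_top), 3%:R) ((k, r), 3%:R) /\
  fconnect pface ((k, r), 1) ((k - 1, row_top), 3%:R).
Proof.
elim/row_ind: r => [|r r0 [IH1 IH2]]; split.
- exact: connect0.
- by apply/connect1/eqP; rewrite /= pfaceE eqxx.
- apply: (connect_trans IH1); apply/connect1/eqP.
  by rewrite /= pfaceE (negPf (ord_pred_neq_bot r0)) ord_predK.
- by apply: connect_trans IH2; apply/connect1/eqP; rewrite /= pfaceE (negPf r0).
Qed.

Lemma pface_top k : fconnect pface ((0, row_top), 0) ((k, row_top), 0).
Proof.
elim/Z3P: k => [|k IH]; first exact: connect0.
by apply: connect_trans IH _; apply/connect1/eqP; rewrite /= pfaceE eqxx.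
Qed.

Lemma pface_bot k :
  fconnect pface ((0, row_bot), 2%:R) ((k, row_bot), 2%:R).
Proof.
rewrite fconnect_sym; last exact: pface_inj.
elim/Z3P: k => [|k IH]; first exact: connect0.
apply: connect_trans IH; apply/connect1/eqP.
by rewrite /= pfaceE eqxx addrK.
Qed.

Lemma pretzel_euler :
  fcard (rotV \o pedge) {: pdart} = (#|pcrossing| + 2)%N.
Proof.
rewrite (@fcard_classify _ _ pface pcl prep) ?card_option ?addn2 //.
- exact: pface_inj.
- case=> [[k r] i]; elim/Z4P: i; rewrite pfaceE; case: ifP => [/eqP->|/negbT r0];
    rewrite /pcl /= ?eqxx ?addrK //.
  + by rewrite (negPf r0) (negPf (ord_pred_neq_bot r0)) ord_predK.
  + by rewrite (negPf r0) (negPf (ordS_neq_top r0)).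
- case=> [[[k r]|]|]; rewrite /= ?eqxx //.
  by case: ifP => [/eqP->|r0] /=; rewrite ?r0.
- case=> [[k r] i]; elim/Z4P: i => /=.
  + by case: ifP => [/eqP->|r0] /=; rewrite ?r0 ?pface_top.
  + rewrite fconnect_sym; last exact: pface_inj.
    by have [_] := pface_side k r.
  + case: ifP => [/eqP->|/negbT r0] /=; rewrite ?pface_bot //.
    rewrite (negPf (ordS_neq_top r0)); apply/connect1/eqP.
    by rewrite /= pfaceE (negPf (ordS_neq_top r0)) ordSK.
  + by have [] := pface_side k r.
Qed.

Lemma pretzel_connected d d' :
  connect [rel x y | (y == pedge x) || (y == rot x)] d d'.
Proof.
set e := [rel x y | _].
have eR x : connect e x (rot x) by apply: connect1; rewrite /= eqxx orbT.
have eE x : connect e x (pedge x) by apply: connect1; rewrite /= eqxx.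
have turn c i j : connect e (c, i) (c, j).
  rewrite -(subrK i j) addrC -(natr_Zp (j - i)).
  elim: (nat_of_ord _) => [|n IHn]; first by rewrite addr0 connect0.
  by apply: connect_trans IHn _; rewrite mulrSr addrA; apply: eR.
have step x c i : pedge (x, i) = (c, (pedge (x, i)).2) ->
    connect e (x, 0) (c, 0).
  move=> E; apply: connect_trans (turn x 0 i) _.
  by apply: connect_trans (eE _) _; rewrite E; apply: turn.
have vert k r : connect e ((k, row_top), 0) ((k, r), 0) /\
                connect e ((k, r), 0) ((k, row_top), 0).
  elim/row_ind: r => [|r r0 [IH1 IH2]]; first by split; apply: connect0.
  split.
    apply: connect_trans IH1 _; apply: (step _ _ 3%:R).
    have := ord_pred_neq_bot r0; rewrite -row_botE /= => /negPf->.
    by rewrite ord_predK.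
  apply: connect_trans IH2; apply: (step _ _ 0).
  by move: r0; rewrite -row_topE /= => /negPf->.
have horiz k k' : connect e ((k, row_top), 0) ((k', row_top), 0).
  rewrite -(subrK k k') addrC; elim/Z3P: (k' - k) => [|l IHl].
    by rewrite addr0 connect0.
  by apply: connect_trans IHl _; rewrite addrA; apply: (step _ _ 0).
case: d d' => [[k r] i] [[k' r'] i'].
apply: connect_trans (turn _ i 0) _; apply: connect_trans (turn _ 0 i').
apply: connect_trans (proj2 (vert k r)) _.
exact: connect_trans (horiz k k') (proj1 (vert k' r')).
Qed.

Definition pretzel_diagram : diagram :=
  Diagram pinf pedgeK pedge_neq pover_rot pout_edge pout_opp
    pretzel_connected pretzel_euler.

Lemma ptau_inf : fconnect pface pinf (rotV (ptau pinf)).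
Proof.
apply/connect1/eqP; rewrite /= pfaceE eqxx /rotV /ptau /=.
by congr (_, _, _); apply/val_inj.
Qed.

Definition pretzel : si_diagram :=
  @SIDiagram pretzel_diagram ptau ptauK ptau_rot ptau_edge ptau_over ptau_out
    ptau_inf.

Lemma pretzel_positive (c : pcrossing) :
  @positive pretzel c = (c.1 != 1).
Proof.
case: c => k r; apply/existsP/idP => [[i]|/= k1].
  elim/Z4P: i; rewrite /= /pover /pout /=;
    by case: (k == 1); case: (odd r); rewrite ?inE.
exists (if odd r then 1 else 3%:R).
by rewrite /= /pover /pout /= (negPf k1); case: (odd r).
Qed.

End Pretzel.

(* Main.v *)
(* Over R = F_2[h] the maps X -> h and X -> 0 identify A with a subring of
   R x R, so a chain is determined by its values at the colourings k of the
   circles by true (X -> h) and false (X -> 0).  In these coordinates an edge of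
   the cube multiplies by 1 (merge) or h (split) the values at the colourings
   that are constant around the crossing and kills the others, and the Lee cycle
   is h^r times the indicator of one colouring.

   Write w for the chain with the labels of the Lee cycle on the top, bottom and
   outer circles and 1 on the inner circles of the central column; it is a
   tau-invariant cycle.  Modulo the image of the central crossings the labels X
   and Y of neighbouring circles agree, so the Lee cycle is homologous to
   h^(p-1) w, invariantly under tau.  Transporting the label of the top circle
   down to the bottom circle shows in the same way that w is h u plus a boundary
   plus an error e + tau e coming from the bottom crossings of the two outer
   columns, with d e = h g.  In the second copy of CKh in the mapping cone,
   e + tau e is homologous to d e, hence w becomes divisible by h.

   The upper bounds come from functionals with phi d = 0.  The one bounding the
   upper invariant sums the coordinates over the colourings of the Seifert
   resolution that alternate along the central column; it is tau-invariant.  The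
   one bounding the lower invariant is the ribbon disc obtained by cutting the
   right column: it sums the coordinates over colourings symmetric under the
   exchange of the left and central columns, over all resolutions where these
   columns are smoothed alike and the right column is cut.  In characteristic 2
   such sums are divisible by a large power of h, because flipping the colour of
   a family of circles with no label X is a fixed-point free involution. *)

Require Import Defs.
From mathcomp Require Import all_boot all_order all_algebra.
From mathcomp Require Import all_fingroup zify.
Require Import Defs.

Set Implicit Arguments.
Unset Strict Implicit.
Unset Printing Implicit Defensive.

Import GRing.Theory.
Local Open Scope ring_scope.

(** * Arithmetic in characteristic 2 and parity of darts *)

Lemma addRR (x : R) : x + x = 0.
Proof. by apply: addrr_pchar2; rewrite pchar_poly. Qed.

Lemma opprR (x : R) : - x = x.
Proof. by apply: oppr_pchar2; rewrite pchar_poly. Qed.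

Lemma h_neq0 n : h ^+ n != 0.
Proof. by rewrite expf_neq0 // polyX_eq0. Qed.

Lemma h_neq1 : h != 1.
Proof.
apply/eqP=> /(congr1 (fun q : {poly 'F_2} => size q)).
by rewrite size_polyX size_poly1.
Qed.

Lemma rot_rot (C : finType) (d : C * 'Z_4) : rot (rot (rot (rot d))) = d.
Proof. by rewrite (rot4 d) !rotVK. Qed.

Lemma rot2 (C : finType) (c : C) : rot (rot (c, 0)) = (c, 2%:R).
Proof. by congr (_, _); apply/val_inj. Qed.

Lemma Z4_val (i : 'Z_4) : odd (val (i + 1)) = ~~ odd (val i).
Proof. by elim/Z4P: i. Qed.

Lemma Z4_valV (i : 'Z_4) : odd (val (i - 1)) = ~~ odd (val i).
Proof. by elim/Z4P: i. Qed.

(** * Circles of neighbouring resolutions *)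

Section Circles.
Variable L : diagram.
Implicit Types (v : vertex L) (c : dg_crossing L) (d x y : dart L).
Implicit Types (k l : {ffun dart L -> bool}).

Lemma circ_sym v : connect_sym (circ_rel v).
Proof.
apply: sym_connect_sym => x y /=; congr (_ || _); apply/eqP/eqP => ->.
- by rewrite dg_edgeK.
- by rewrite dg_edgeK.
- by rewrite smoothK.
- by rewrite smoothK.
Qed.

Lemma same_circle_sym v x y : same_circle v x y = same_circle v y x.
Proof. exact: circ_sym. Qed.

Lemma same_circle_edge v d : same_circle v d (dg_edge d).
Proof. by apply: connect1; rewrite /circ_rel /= eqxx. Qed.

Lemma same_circle_smooth v d : same_circle v d (smooth v d).
Proof. by apply: connect1; rewrite /circ_rel /= eqxx orbT. Qed.

Lemma circle_ind v (P : dart L -> Prop) x y :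
  (forall d, P d -> P (dg_edge d)) -> (forall d, P d -> P (smooth v d)) ->
  same_circle v x y -> P x -> P y.
Proof.
move=> Pe Ps /connectP[q]; elim: q x => [|z q IHq] x /=; first by move=> _ ->.
by case/andP=> xz /IHq H /H {}H Px; apply: H; case/orP: xz => /eqP->; auto.
Qed.

Lemma labellingP v l : reflect
  ((forall d, l (dg_edge d) = l d) /\ (forall d, l (smooth v d) = l d))
  (labelling v l).
Proof.
apply: (iffP forallP) => [H|[He Hs] d]; last by rewrite He Hs !eqxx.
by split=> d; have /andP[/eqP A /eqP B] := H d.
Qed.

Lemma labelling_circle v l x y :
  labelling v l -> same_circle v x y -> l x = l y.
Proof.
move=> /labellingP[He Hs] H; apply:
  (circle_ind (P := fun d => l x = l d)) H _ => //.
  by move=> d ->.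
by move=> d ->.
Qed.

Definition addc v c : vertex L := [ffun b => (b == c) || v b].
Definition subc v c : vertex L := [ffun b => (b != c) && v b].

Lemma addcK v c : ~~ v c -> subc (addc v c) c = v.
Proof.
by move=> /negPf vc; apply/ffunP=> b; rewrite !ffunE; case: eqP => [->|].
Qed.

Lemma subcK v c : v c -> addc (subc v c) c = v.
Proof.
by move=> vc; apply/ffunP=> b; rewrite !ffunE; case: eqP => [->|].
Qed.

Lemma smooth_eq v v' d : v' d.1 = v d.1 -> smooth v' d = smooth v d.
Proof. by rewrite /smooth => ->. Qed.

(** Opposite darts have the same over/under type, and [rot] and [rotV] differ by a half turn; so the
    other smoothing at a crossing is the old one applied to the opposite dart. *)
Lemma smooth_neq v v' d :
  v' d.1 = ~~ v d.1 -> smooth v' d = smooth v (rot (rot d)).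
Proof.
rewrite /smooth /= => ->; rewrite !dg_over_rot negbK addbN.
by case: (_ (+) _); rewrite /= ?rotK // rot4 rotK.
Qed.

Lemma addc_smooth v c d : ~~ v c ->
  smooth (addc v c) d = smooth v (if d.1 == c then rot (rot d) else d).
Proof.
move=> vc; case: eqP => [E|/eqP E];
  first by rewrite (@smooth_neq v) // ffunE E eqxx vc.
by rewrite (@smooth_eq v) // ffunE (negPf E).
Qed.

Lemma smooth_fst v d : (smooth v d).1 = d.1.
Proof. by rewrite /smooth; case: ifP. Qed.

Lemma smooth_dart v c (i : 'Z_4) :
  smooth v (c, i) = if dg_over (c, i) (+) v c then (c, i - 1) else (c, i + 1).
Proof. by []. Qed.

(** Either smoothing joins each of the darts 1 and 3 to dart 0 or dart 2. *)
Lemma touches_sub v c d : touches v c d =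
  same_circle v (c, 0) d || same_circle v (c, 2%:R) d.
Proof.
have eqv := symmetric_from_pre; have S := same_circle_smooth v.
apply/existsP/orP => [[i]|[H|H]]; last 2 first; first by exists 0.
  by exists 2%:R.
have T a b : same_circle v a b -> same_circle v b d -> same_circle v a d.
  exact: connect_trans.
have N j : dg_over (c, j + 1) = ~~ dg_over (c, j).
  by rewrite -[(c, j + 1)]/(rot (c, j)) dg_over_rot.
have E j : smooth v (c, j) = (c, j + 1) \/ smooth v (c, j) = (c, j - 1).
  by rewrite smooth_dart; case: ifP; [right|left].
elim/Z4P: i; [by left| | by right| ].
- case: (E 1) => E1 H; [right|left]; apply: T H; rewrite same_circle_sym.
  + by have := S (c, 1); rewrite E1 (_ : 1 + 1 = 2%:R).
  + by have := S (c, 1); rewrite E1 subrr.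
- case: (E 3%:R) => E1 H; [left|right]; apply: T H; rewrite same_circle_sym.
  + by have := S (c, 3%:R); rewrite E1 (_ : 3%:R + 1 = 0) //; apply/val_inj.
  + by have := S (c, 3%:R); rewrite E1 (_ : 3%:R - 1 = 2%:R) //; apply/val_inj.
Qed.

Lemma labelling_const v k c : labelling v k ->
  k (c, 0) = k (c, 2%:R) -> forall i, k (c, i) = k (c, 0).
Proof.
move=> kv E i; have: touches v c (c, i) by apply/existsP; exists i; apply: connect0.
by rewrite touches_sub => /orP[]/(labelling_circle kv) <-.
Qed.

(** A colouring that is constant around [c] is compatible with both smoothings there. This lets one
    colouring be used at both ends of an edge of the cube. *)
Lemma labelling_transfer v v' k c : (forall b, b != c -> v' b = v b) ->
  k (c, 0) = k (c, 2%:R) -> labelling v k -> labelling v' k.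
Proof.
move=> vv E kv; have [He Hs] := labellingP _ _ kv; apply/labellingP; split=> // d.
case: (d.1 =P c) => [dc|/eqP dc]; last by rewrite (@smooth_eq v) ?vv.
have C := labelling_const kv E.
have := smooth_fst v' d; case: (smooth v' d) => b i /= ->.
by case: d dc => b' j /= ->; rewrite !C.
Qed.

End Circles.

(** * Every edge of the cube is a merge or a split *)

Section Alternating.
Variable L : diagram.
Hypothesis edge_odd :
  forall d : dart L, odd (val (dg_edge d).2) = ~~ odd (val d.2).
Implicit Types (v : vertex L) (c : dg_crossing L) (d x y : dart L).
Implicit Types (k l : {ffun dart L -> bool}).

Lemma smooth_odd v d : odd (val (smooth v d).2) = ~~ odd (val d.2).
Proof. by rewrite /smooth; case: ifP => _; rewrite ?Z4_val ?Z4_valV. Qed.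

(* Every circle alternates between even and odd darts, so it is described by
   the permutation edge \o smooth of its even darts; changing the smoothing of
   a crossing multiplies this permutation by a transposition. *)
Definition cmap v d : dart L :=
  if odd (val d.2) then d else dg_edge (smooth v d).

Lemma cmap_odd v d : odd (val (cmap v d).2) = odd (val d.2).
Proof.
by rewrite /cmap; case: ifP => // o; rewrite edge_odd smooth_odd o.
Qed.

Lemma cmap_inj v : injective (cmap v).
Proof.
move=> x y E; have o : odd (val x.2) =
  odd (val y.2) by rewrite -(cmap_odd v x) E cmap_odd.
move: E; rewrite /cmap o; case: ifP => // _.
by move/(inv_inj (@dg_edgeK L))/(inv_inj (smoothK v)).
Qed.

Definition cperm v : {perm dart L} := perm (@cmap_inj v).

Lemma same_circle_porbit v x y : ~~ odd (val x.2) -> ~~ odd (val y.2) ->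
  same_circle v x y = (y \in porbit (cperm v) x).
Proof.
move=> ox oy; apply/idP/idP.
  (* An odd dart is represented by the even dart to which the smoothing joins it, so that [P] can be
     followed along every step of a circle. *)
  pose P d := (if odd (val d.2) then smooth v d else d) \in porbit (cperm v) x.
  have E d : ~~ odd (val d.2) -> cperm v d = dg_edge (smooth v d).
    by move=> /negPf o; rewrite permE /cmap o.
  have M a : (cperm v a \in porbit (cperm v) x) = (a \in porbit (cperm v) x).
    by rewrite -!eq_porbit_mem -(porbit_perm (cperm v) 1 a) expg1.
  move=> xy; suff: P y by rewrite /P (negPf oy).
  apply: (circle_ind (P := P)) xy _; last by rewrite /P (negPf ox) porbit_id.
    move=> d; rewrite /P edge_odd; case: ifP => /= o.
    by rewrite -{2}(smoothK v d) -E ?M // smooth_odd o.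
  have A : cperm v (smooth v (dg_edge d)) = d.
    by rewrite E ?smoothK ?dg_edgeK // smooth_odd edge_odd o.
  by rewrite -{1}A M.
  by move=> d; rewrite /P smooth_odd smoothK; case: ifP.
have step z : same_circle v z (cperm v z).
  rewrite permE /cmap; case: ifP => _; first exact: connect0.
  exact: connect_trans (same_circle_smooth _ _) (same_circle_edge _ _).
case/porbitP=> n ->; elim: n => [|n IHn].
  by rewrite expg0 perm1; apply: connect0.
by apply: connect_trans IHn _; rewrite expgSr permM; apply: step.
Qed.

Lemma cperm_addc v c : ~~ v c ->
  cperm (addc v c) = (tperm ((c, 0%R) : dart L) (c, 2%:R) * cperm v)%g.
Proof.
move=> vc; apply/permP=> d; rewrite permM [LHS]permE [RHS]permE /cmap.
rewrite addc_smooth //; case: tpermP => [->|->|] /=.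
- by rewrite eqxx rot2.
- by rewrite eqxx -rot2 rot_rot.
case: ifP => // o; case: eqP => // dc; case: d dc o => b i /= ->.
by elim/Z4P: i => //.
Qed.

(** [porbits_mul_tperm] gives the change in the number of orbits from [s] to [tperm x y * s] and
    back. The two changes cancel only if the two memberships are opposite. *)
Lemma porbit_tperm_neg (T : finType) (s : {perm T}) (x y : T) : x != y ->
  (y \in porbit (tperm x y * s)%g x) = (y \notin porbit s x).
Proof.
move=> xy; have E (t : {perm T}) : (x \notin porbit t y) = (y \notin porbit t x).
  by rewrite porbit_sym.
have H1 := porbits_mul_tperm s x y;
  have H2 := porbits_mul_tperm (tperm x y * s) x y.
rewrite /= in H1 H2; rewrite xy !E in H1; rewrite mulgA tperm2 mul1g xy !E /= in H2.
case: (y \in porbit s x) H1; case: (y \in porbit _ x) H2 => //=; lia.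
Qed.

Lemma same_circle_addc v c : ~~ v c ->
  same_circle (addc v c) (c, 0) (c, 2%:R) = ~~ same_circle v (c, 0) (c, 2%:R).
Proof.
move=> vc; rewrite !same_circle_porbit // cperm_addc // porbit_tperm_neg //.
by rewrite xpair_eqE eqxx.
Qed.

(* The coefficient of the edge from v to addc v c, see coord_d. *)
Definition edge_coef v c : R := if same_circle v (c, 0) (c, 2%:R) then h else 1.

Lemma edge_coef_merge v c k : labelling v k -> k (c, 0) != k (c, 2%:R) ->
  edge_coef v c = 1.
Proof.
by rewrite /edge_coef => kv; case: ifP => // /(labelling_circle kv)->; rewrite eqxx.
Qed.

Lemma edge_coef_split v c k : ~~ v c -> labelling (addc v c) k ->
  k (c, 0) != k (c, 2%:R) -> edge_coef v c = h.
Proof.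
rewrite /edge_coef => vc kv; case: ifP => // /negbT.
by rewrite -same_circle_addc // => /(labelling_circle kv)->; rewrite eqxx.
Qed.

Lemma merge_const v c k : ~~ v c -> labelling (addc v c) k ->
  edge_coef v c = 1 -> k (c, 0) = k (c, 2%:R).
Proof.
rewrite /edge_coef => vc kv; case: ifP => [_ /eqP|/negbT].
  by rewrite (negPf h_neq1).
by rewrite -same_circle_addc // => /(labelling_circle kv)->.
Qed.

End Alternating.

(** * Lee coordinates *)

(* The value of the label 1 or X at the colour b. *)
Definition lee_val (a b : bool) : R := if a then (if b then h else 0) else 1.

(** Both [h] and 0 are roots of x^2 = hx, so the evaluation of labels is a ring homomorphism. *)
Lemma mulA_lee_val a a' b : \sum_x mulA a a' x * lee_val x b =
  lee_val a b * lee_val a' b.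
Proof.
rewrite big_bool /mulA /lee_val; move: h => q.
by case: a a' b => [] [] [] /=; rewrite ?(mul0r, mul1r, mulr0, addr0, add0r, mulr1).
Qed.

(** Delta 1 evaluates at (x, y) to x + y - h, which is 0 when x and y are the two different roots,
    and [h] up to sign when they are equal; characteristic 2 removes the sign. *)
Lemma comulA_lee_val a b b' :
  \sum_x \sum_y comulA a x y * (lee_val x b * lee_val y b') =
    (b == b')%:R * h * lee_val a b.
Proof.
rewrite !big_bool /= /comulA /lee_val opprR; have := addRR h; move: h => q qq.
case: a b b' => [] [] [] /=;
  rewrite ?(mul0r, mul1r, mulr0, addr0, add0r, mulr1, qq) //.
Qed.

Section LeeCoordinates.
Variable L : diagram.
Implicit Types (v : vertex L) (c : dg_crossing L) (d x y : dart L).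
Implicit Types (k l : {ffun dart L -> bool}) (z : CKh L).

Definition lee_ev v k l : R := \prod_(d | roots (circ_rel v) d) lee_val (l d) (k d).

Definition coord v k z : R :=
  \sum_(t : gen L | (val t).1 == v) z t * lee_ev v k (val t).2.

Lemma coordD v k z z' : coord v k (z + z') = coord v k z + coord v k z'.
Proof.
by rewrite -big_split; apply: eq_bigr => t _; rewrite ffunE mulrDl.
Qed.

Lemma coordZ v k (a : R) z : coord v k (a *: z) = a * coord v k z.
Proof. by rewrite mulr_sumr; apply: eq_bigr => t _; rewrite ffunE mulrA. Qed.

Lemma coord0 v k : coord v k 0 = 0.
Proof. by rewrite -(scale0r 0) coordZ mul0r. Qed.

Lemma coordN v k z : coord v k (- z) = coord v k z.
Proof. by rewrite -scaleN1r coordZ mulN1r opprR. Qed.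

Lemma coord_sum v k (I : finType) (P : pred I) (f : I -> CKh L) :
  coord v k (\sum_(i | P i) f i) = \sum_(i | P i) coord v k (f i).
Proof. by apply: (big_morph _ (coordD v k)); apply: coord0. Qed.

Lemma same_circle_trans v x y d :
  same_circle v x y -> same_circle v y d -> same_circle v x d.
Proof. exact: connect_trans. Qed.

Lemma circle_root v d : same_circle v d (fingraph.root (circ_rel v) d).
Proof. exact: connect_root. Qed.

Lemma roots_circle v x d : roots (circ_rel v) d && same_circle v x d =
  (d == fingraph.root (circ_rel v) x).
Proof.
apply/andP/eqP => [[/eqP rd xd]|->].
  by rewrite -[LHS]rd; apply/eqP; rewrite (root_connect (@circ_sym _ _)) circ_sym.
by split; [apply: roots_root (@circ_sym _ _) _|apply: circle_root].
Qed.

Lemma prod_circle v x (F : dart L -> R) :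
  (forall d d', same_circle v d d' -> F d = F d') ->
  \prod_(d | roots (circ_rel v) d && same_circle v x d) F d = F x.
Proof.
move=> HF; rewrite (big_pred1 (fingraph.root (circ_rel v) x)).
  by apply/esym/HF/circle_root.
by move=> d; rewrite roots_circle.
Qed.

(** Splits off the circles through [c]; the conditional avoids counting one circle twice when both
    arcs lie on it. *)
Lemma prod_touches v c (F : dart L -> R) :
  (forall d d', same_circle v d d' -> F d = F d') ->
  \prod_(d | roots (circ_rel v) d) F d =
  F (c, 0) * (if same_circle v (c, 0) (c, 2%:R) then 1 else F (c, 2%:R)) *
  \prod_(d | roots (circ_rel v) d && ~~ touches v c d) F d.
Proof.
move=> HF; rewrite (bigID (touches v c)) /=; congr (_ * _).
rewrite (bigID (same_circle v (c, 0))) /=; congr (_ * _).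
  rewrite -(prod_circle _ HF); apply: eq_bigl => d; rewrite touches_sub.
  by case: same_circle; rewrite ?andbT ?andbF.
case: ifP => xy.
  apply: big1 => d; rewrite touches_sub => /andP[/andP[_ /orP[->|]] //].
  by move=> yd; rewrite (same_circle_trans xy yd).
rewrite -(prod_circle _ HF); apply: eq_bigl => d; rewrite touches_sub.
case E: (same_circle v (c, 0) d); rewrite /= ?andbT ?andbF //.
case G: (same_circle v (c, 2%:R) d); rewrite ?andbF //.
by move: G; rewrite same_circle_sym => /(same_circle_trans E); rewrite xy.
Qed.

Section OffCrossing.
Variables (v v' : vertex L) (c : dg_crossing L).
Hypothesis vv : forall b, b != c -> v' b = v b.

Lemma touches_closed w d : touches w c (dg_edge d) = touches w c d /\
  touches w c (smooth w d) = touches w c d.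
Proof.
have T a b b' : same_circle w b b' -> same_circle w a b = same_circle w a b'.
  by move=> H; apply/idP/idP => H'; apply: same_circle_trans H' _ => //;
    rewrite same_circle_sym.
split; rewrite !touches_sub; congr (_ || _); apply/esym/T;
  by [apply: same_circle_edge|apply: same_circle_smooth].
Qed.

Lemma touches_self w i : touches w c (c, i).
Proof. by apply/existsP; exists i; apply: connect0. Qed.

Lemma touches_smooth d : touches v c (smooth v' d) = touches v c d.
Proof.
case: (d.1 =P c) => [dc|/eqP dc]; last first.
  by rewrite (@smooth_eq _ v) ?vv //; have [] := touches_closed v d.
have := smooth_fst v' d; case: (smooth v' d) => b i /= ->.
by case: d dc => b' j /= ->; rewrite !touches_self.
Qed.

Lemma touches_imp d : touches v' c d -> touches v c d.
Proof.
case/existsP=> i H; apply: (circle_ind (P := fun e => touches v c e)) H _.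
- by move=> e; have [-> _] := touches_closed v e.
- by move=> e; rewrite touches_smooth.
exact: touches_self.
Qed.

Lemma same_circle_imp d d' :
  ~~ touches v c d -> same_circle v d d' -> same_circle v' d d'.
Proof.
move=> td H; suff [] : ~~ touches v c d' /\ same_circle v' d d' by [].
apply: (circle_ind (P := fun e => ~~ touches v c e /\ same_circle v' d e)) H _.
- move=> e [te de]; have [-> _] := touches_closed v e; split=> //.
  exact: connect_trans de (same_circle_edge _ _).
- move=> e [te de]; have [_ ->] := touches_closed v e; split=> //.
  apply: same_circle_trans de _; rewrite -(@smooth_eq _ v v'); last first.
    apply: vv; apply: contraNneq te; case: (e) => b i /= ->.
    exact: touches_self.
  exact: same_circle_smooth.
by split=> //; apply: connect0.
Qed.

End OffCrossing.

Lemma touches_off v v' c d : (forall b, b != c -> v' b = v b) ->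
  touches v' c d = touches v c d.
Proof.
move=> vv; apply/idP/idP; apply: touches_imp => //.
by move=> b /vv.
Qed.

Lemma roots_off v v' c d : (forall b, b != c -> v' b = v b) ->
  ~~ touches v c d -> roots (circ_rel v') d = roots (circ_rel v) d.
Proof.
move=> vv td; have vv' b : b != c -> v b = v' b by move/vv.
(* A root is picked among the darts connected to [d], so equal connectivity predicates give equal
   roots. *)
have E : fingraph.root (circ_rel v') d = fingraph.root (circ_rel v) d.
  congr odflt; apply: eq_pick => d'.
  apply/idP/idP; last exact: (same_circle_imp vv td).
  by apply: (same_circle_imp vv'); rewrite (touches_off _ vv).
by rewrite -[LHS]/(fingraph.root _ d == d) -[RHS]/(fingraph.root _ d == d) E.
Qed.

Lemma dcoefE c (s t : gen L) : dcoef_at c s t =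
  if [&& ~~ (val s).1 c, (val t).1 == addc (val s).1 c
       & [forall d, touches (val s).1 c d || ((val t).2 d == (val s).2 d)]] then
    if same_circle (val s).1 (c, 0) (c, 2%:R) then
      comulA ((val s).2 (c, 0)) ((val t).2 (c, 0)) ((val t).2 (c, 2%:R))
    else mulA ((val s).2 (c, 0)) ((val s).2 (c, 2%:R)) ((val t).2 (c, 0))
  else 0.
Proof. by rewrite /dcoef_at; case: (val s) => v l; case: (val t). Qed.

Lemma sum_support (I J : finType) (u : I -> J) (g : J -> I) (F : J -> R) :
  cancel u g -> (forall j, u (g j) != j -> F j = 0) ->
  \sum_j F j = \sum_i F (u i).
Proof.
move=> ug F0; rewrite (bigID (fun j => u (g j) == j)) /= addrC big1 // add0r.
rewrite (reindex_onto u g) => [|j /eqP //]; apply: eq_bigl => i.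
by rewrite ug !eqxx.
Qed.

Section Edge.
Hypothesis edge_odd :
  forall d : dart L, odd (val (dg_edge d).2) = ~~ odd (val d.2).
Variables (v : vertex L) (c : dg_crossing L).
Hypothesis vc : ~~ v c.

Lemma addc_off b : b != c -> addc v c b = v b.
Proof. by rewrite ffunE => /negPf->. Qed.

Lemma touches_addc d : touches (addc v c) c d = touches v c d.
Proof. exact: touches_off addc_off. Qed.

Lemma roots_addc d : ~~ touches v c d ->
  roots (circ_rel (addc v c)) d = roots (circ_rel v) d.
Proof. exact: roots_off addc_off. Qed.

Lemma roots_addc_off d :
  roots (circ_rel (addc v c)) d && ~~ touches (addc v c) c d =
  roots (circ_rel v) d && ~~ touches v c d.
Proof.
rewrite touches_addc; case: (boolP (touches v c d)) => td.
  exact: etrans (andbF _) (esym (andbF _)).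
by rewrite roots_addc.
Qed.

(** The new labels on the circles through [c] after the edge. When these circles are merged the
    first test wins and [b] is ignored, so one definition serves merges and splits. *)
Definition relabel l a b : {ffun dart L -> bool} :=
  [ffun d => if same_circle (addc v c) (c, 0) d then a
             else if same_circle (addc v c) (c, 2%:R) d then b else l d].

Lemma relabel_off l a b d : ~~ touches v c d -> relabel l a b d = l d.
Proof.
rewrite -touches_addc touches_sub ffunE negb_or.
by case/andP=> /negPf-> /negPf->.
Qed.

Lemma relabelP l a b : labelling v l -> labelling (addc v c) (relabel l a b).
Proof.
move=> /labellingP[He Hs].
have T x d d' : same_circle (addc v c) d d' ->
    same_circle (addc v c) x d = same_circle (addc v c) x d'.
  by move=> H; apply/idP/idP => H'; apply: same_circle_trans H' _ => //;
    rewrite same_circle_sym.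
apply/labellingP; split=> d.
  by rewrite !ffunE He -!(T _ _ _ (same_circle_edge _ d)).
case td: (touches v c d).
  move: td; rewrite -touches_addc touches_sub !ffunE.
  by rewrite -!(T _ _ _ (same_circle_smooth _ d)); do 2!case: same_circle.
rewrite !relabel_off ?td ?(touches_smooth addc_off) ?td //.
rewrite (@smooth_eq _ v) ?Hs //; apply: addc_off.
by apply: contraFneq td; case: (d) => b' i /= ->; apply: touches_self.
Qed.

Lemma relabel0 l a b : relabel l a b (c, 0) = a.
Proof. by rewrite ffunE /same_circle connect0. Qed.

Lemma relabel2 l a b : ~~ same_circle (addc v c) (c, 0) (c, 2%:R) ->
  relabel l a b (c, 2%:R) = b.
Proof. by rewrite ffunE => /negPf->; rewrite /same_circle connect0. Qed.

Lemma relabelK l l' : labelling (addc v c) l' ->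
  [forall d, touches v c d || (l' d == l d)] ->
  relabel l (l' (c, 0)) (l' (c, 2%:R)) = l'.
Proof.
move=> Hl' /forallP H; apply/ffunP=> d; case td: (touches v c d); last first.
  by have := H d; rewrite td relabel_off ?td // => /eqP.
move: td; rewrite -touches_addc touches_sub ffunE.
case: ifP => [/(labelling_circle Hl')//|_].
by case: ifP => [/(labelling_circle Hl')//|].
Qed.

Lemma lee_ev_const (w : vertex L) k l : labelling w k -> labelling w l ->
  forall d d', same_circle w d d' -> lee_val (l d) (k d) = lee_val (l d') (k d').
Proof.
by move=> kw lw d d' H; rewrite (labelling_circle kw H) (labelling_circle lw H).
Qed.

(** Circles away from [c] contribute the same factor [Off k] on both sides, which leaves the
    identities for [mulA] and [comulA] at the circles through [c]. *)
Lemma edge_sum (s : gen L) k : (val s).1 = v -> labelling (addc v c) k ->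
  \sum_(t : gen L | (val t).1 == addc v c)
     dcoef_at c s t * lee_ev (addc v c) k (val t).2 =
  (k (c, 0) == k (c, 2%:R))%:R * edge_coef v c * lee_ev v k (val s).2.
Proof.
move=> sv kv; have ls : labelling v (val s).2 by rewrite -sv; apply: (valP s).
rewrite big_rmcond; last first.
  by move=> t /negPf E; rewrite dcoefE sv E andbF mul0r.
(* The generators [u ab] exhaust the targets with a nonzero coefficient: pairs of labels for a
   split, diagonal pairs for a merge. *)
pose u ab : gen L := exist (fun s =>
  labelling s.1 s.2) (addc v c, relabel (val s).2 ab.1 ab.2)
  (relabelP ab.1 ab.2 ls).
pose Off k := \prod_(d | roots (circ_rel v) d && ~~ touches v c d)
  lee_val ((val s).2 d) (k d).
have evu ab : lee_ev (addc v c) k (val (u ab)).2 = lee_val ab.1 (k (c, 0)) *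
    (if same_circle (addc v c) (c, 0) (c, 2%:R) then 1
     else lee_val ab.2 (k (c, 2%:R))) * Off k.
  rewrite /lee_ev (prod_touches c (lee_ev_const kv (valP (u ab)))) /= relabel0.
  congr (_ * _ * _); first by case: ifP => // /negbT/relabel2->.
  apply: eq_big => [d|d]; first exact: roots_addc_off.
  by case/andP=> _; rewrite touches_addc => td; rewrite relabel_off.
have ev0 : k (c, 0) = k (c, 2%:R) -> lee_ev v k (val s).2 =
    lee_val ((val s).2 (c, 0)) (k (c, 0)) *
      (if same_circle v (c, 0) (c, 2%:R) then 1
      else lee_val ((val s).2 (c, 2%:R)) (k (c, 2%:R))) * Off k.
  move=> E; rewrite /lee_ev (prod_touches c (lee_ev_const _ ls)) //.
  by apply: (labelling_transfer (c := c) _ E kv) => b /addc_off.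
have dcu ab : dcoef_at c s (u ab) =
    if same_circle v (c, 0) (c, 2%:R) then
      comulA ((val s).2 (c, 0)) (relabel (val s).2 ab.1 ab.2 (c, 0))
        (relabel (val s).2 ab.1 ab.2 (c, 2%:R))
    else mulA ((val s).2 (c, 0)) ((val s).2 (c, 2%:R))
        (relabel (val s).2 ab.1 ab.2 (c, 0)).
  rewrite dcoefE sv vc eqxx; case: ifP => // /forallP[] d /=.
  by case td: (touches v c d) => //=; rewrite relabel_off ?td.
case sp: (same_circle v (c, 0) (c, 2%:R)).
  have ns : ~~ same_circle (addc v c) (c, 0) (c, 2%:R).
    by rewrite same_circle_addc // sp.
  rewrite (sum_support (u := u)
    (g := fun t : gen L => ((val t).2 (c, 0), (val t).2 (c, 2%:R)))); first last.
  - move=> t ut; rewrite dcoefE sv; case: ifP;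
    rewrite ?mul0r // => /and3P[_ /eqP tv H].
    have lt : labelling (addc v c) (val t).2 by rewrite -tv; apply: (valP t).
    case/eqP: ut; apply/val_inj; rewrite /= relabelK // -tv.
    exact/esym/surjective_pairing.
  - by case=> a b; rewrite /= relabel0 relabel2.
  transitivity (\sum_x \sum_y (comulA ((val s).2 (c, 0)) x y *
    (lee_val x (k (c, 0)) * lee_val y (k (c, 2%:R)))) * Off k).
    rewrite pair_bigA; apply: eq_bigr => -[a b] _.
    rewrite [LHS](congr2 *%R (dcu (a, b)) (evu (a, b))) sp (negPf ns) /=.
    by rewrite relabel0 relabel2 // -!mulrA.
  under eq_bigr => x _ do rewrite -mulr_suml.
  rewrite -mulr_suml comulA_lee_val /edge_coef sp -!mulrA; case: eqP => [E|_];
    last by rewrite !mul0r.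
  by rewrite (ev0 E) sp mulr1.
have ns : same_circle (addc v c) (c, 0) (c, 2%:R).
  by rewrite same_circle_addc // sp.
have E : k (c, 0) = k (c, 2%:R) by apply: labelling_circle ns.
rewrite (sum_support (u := fun a => u (a, a))
  (g := fun t : gen L => (val t).2 (c, 0))); first last.
- move=> t ut; rewrite dcoefE sv; case: ifP;
  rewrite ?mul0r // => /and3P[_ /eqP tv H].
  have lt : labelling (addc v c) (val t).2 by rewrite -tv; apply: (valP t).
  case/eqP: ut; apply/val_inj; rewrite /= {2}(labelling_circle lt ns) relabelK //
    -tv.
  exact/esym/surjective_pairing.
- by move=> a; rewrite /= relabel0.
transitivity (\sum_x (mulA ((val s).2 (c, 0)) ((val s).2 (c, 2%:R)) x *
    lee_val x (k (c, 0))) * Off k).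
  apply: eq_bigr => a _; rewrite [LHS](congr2 *%R (dcu (a, a)) (evu (a, a))).
  by rewrite sp ns /= relabel0 mulr1 -!mulrA.
rewrite -mulr_suml mulA_lee_val (ev0 E) sp /edge_coef sp -E eqxx !mul1r.
by [].
Qed.

End Edge.

End LeeCoordinates.

(** * The differential, realisation of chains and divisibility in Lee coordinates *)

Section Differential.
Variable L : diagram.
Hypothesis edge_odd :
  forall d : dart L, odd (val (dg_edge d).2) = ~~ odd (val d.2).
Implicit Types (v : vertex L) (c : dg_crossing L) (d x y : dart L).
Implicit Types (k l : {ffun dart L -> bool}) (z : CKh L).

Lemma dKhE z t : dKh z t = \sum_(s : gen L) z s * \sum_c dcoef_at c s t.
Proof. exact: ffunE. Qed.

Lemma coord_d v k z : labelling v k ->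
  coord v k (dKh z) = \sum_(c | v c) (k (c, 0) == k (c, 2%:R))%:R *
     edge_coef (subc v c) c * coord (subc v c) k z.
Proof.
move=> kv.
transitivity (\sum_c \sum_(s : gen L) z s * \sum_(t : gen L | (val t).1 == v)
    dcoef_at c s t * lee_ev v k (val t).2).
  transitivity (\sum_(t : gen L | (val t).1 == v) \sum_(s : gen L)
      z s * (\sum_c dcoef_at c s t * lee_ev v k (val t).2)).
    apply: eq_bigr => t _; rewrite dKhE mulr_suml.
    by apply: eq_bigr => s _; rewrite -mulrA mulr_suml.
  rewrite exchange_big [RHS]exchange_big; apply: eq_bigr => s _.
  by rewrite -!mulr_sumr exchange_big.
rewrite [RHS]big_mkcond; apply: eq_bigr => c _; case: ifP => vc; last first.
  apply: big1 => s _; rewrite big1 ?mulr0 // => t /eqP tv; rewrite dcoefE tv.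
  case: ifP => [/and3P[_ /eqP E]|]; last by rewrite mul0r.
  by move: vc; rewrite E ffunE eqxx.
rewrite mulr_sumr [RHS]big_mkcond; apply: eq_bigr => s _; case: eqP => sv.
  have nvc : ~~ subc v c c by rewrite ffunE eqxx.
  have E := subcK vc; rewrite -{1 2}E (edge_sum edge_odd nvc sv) ?E //.
  by rewrite mulrCA.
rewrite big1 ?mulr0 // => t /eqP tv; rewrite dcoefE tv.
case: ifP => [/and3P[nvc /eqP E]|]; last by rewrite mul0r.
by case: sv; rewrite E addcK.
Qed.

Lemma lee_val_neq0 (a b : bool) : (a -> b) -> lee_val a b != 0.
Proof.
by rewrite /lee_val; case: a; case: b => //= H; rewrite ?oner_eq0 ?(h_neq0 1) //;
  have := H isT.
Qed.

Lemma lee_ev_eq0 v k l d : labelling v k -> labelling v l ->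
  l d -> ~~ k d -> lee_ev v k l = 0.
Proof.
move=> kv lv ld kd; have dr := circle_root v d.
rewrite /lee_ev (bigD1 (fingraph.root (circ_rel v) d)) /=; last first.
  exact: roots_root (@circ_sym _ _) _.
by rewrite -(labelling_circle kv dr) -(labelling_circle lv dr) /lee_val ld (negPf
  kd) mul0r.
Qed.

(** The coordinates are triangular: [lee_ev v k l] vanishes unless every circle labelled X by [l] is
    coloured true by [k], and is nonzero for [k = l]. The induction is on the number of darts
    labelled X. *)
Lemma coord_inj0 z :
  (forall v k, labelling v k -> coord v k z = 0) -> z = 0.
Proof.
move=> H; apply/ffunP=> s; rewrite ffunE.
have [n] := ubnP #|[set d | (val s).2 d]|; elim: n s => // n IHn s /ltnSE sn.
have := H _ _ (valP s); rewrite /coord (bigD1 s) //= big1 =>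
  [/eqP|t /andP[/eqP tv ts]].
  rewrite addr0 mulf_eq0 => /orP[/eqP //|/eqP E].
  have /negP[] : lee_ev (val s).1 (val s).2 (val s).2 != 0.
    by apply/prodf_neq0 => d _; apply: lee_val_neq0.
  by rewrite E.
have lt : labelling (val s).1 (val t).2 by rewrite -tv; apply: (valP t).
have [/forallP A|/forallPn[d]] := boolP [forall d, (val t).2 d ==> (val s).2 d];
  last first.
  by rewrite negb_imply => /andP[td sd];
    rewrite (lee_ev_eq0 (valP s) lt td sd) mulr0.
rewrite IHn ?mul0r //; apply: leq_trans sn; apply/proper_card.
rewrite properEneq; apply/andP; split; last first.
  by apply/subsetP=> d; rewrite !inE; apply: (implyP (A d)).
apply: contraNneq ts => E; apply/eqP/val_inj.
rewrite [val t]surjective_pairing [val s]surjective_pairing tv; congr (_, _).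
by apply/ffunP=> d; move/setP/(_ d): E; rewrite !inE.
Qed.

Lemma coord_inj z z' :
  (forall v k, labelling v k -> coord v k z = coord v k z') -> z = z'.
Proof.
move=> H; apply/eqP; rewrite -subr_eq0; apply/eqP/coord_inj0 => v k kv.
by rewrite coordD coordN H // addRR.
Qed.

Definition delta_gen (s : gen L) : CKh L := [ffun t => (t == s)%:R].

Lemma coord_delta v k s :
  coord v k (delta_gen s) = ((val s).1 == v)%:R * lee_ev v k (val s).2.
Proof.
rewrite /coord big_mkcond (bigD1 s) //= big1 => [|t /negPf ts].
  by rewrite ffunE eqxx addr0; case: eqP; rewrite ?mul0r.
by rewrite ffunE ts mul0r if_same.
Qed.

Lemma CKh_delta z : z = \sum_s z s *: delta_gen s.
Proof.
apply/ffunP=> t; rewrite sum_ffunE (bigD1 t) //= big1 => [|s /negPf st].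
  by rewrite !ffunE eqxx addr0; apply/esym/mulr1.
by rewrite !ffunE eq_sym st scaler0.
Qed.

Definition set_circle v d l : {ffun dart L -> bool} :=
  [ffun e => same_circle v d e || l e].

Lemma set_circleP v d l : labelling v l -> labelling v (set_circle v d l).
Proof.
move=> /labellingP[He Hs]; apply/labellingP; split=> e; rewrite !ffunE ?He ?Hs;
  congr (_ || _); apply/idP/idP => H; apply: same_circle_trans H _;
  rewrite ?same_circle_edge ?same_circle_smooth // same_circle_sym;
  by rewrite ?same_circle_edge ?same_circle_smooth.
Qed.

Lemma lee_ev_set_circle v k l d : labelling v k -> labelling v l -> ~~ l d ->
  lee_ev v k (set_circle v d l) = (if k d then h else 0) * lee_ev v k l.
Proof.
move=> kv lv ld; have dr := circle_root v d.
have rr : roots (circ_rel v) (fingraph.root (circ_rel v) d).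
  exact: roots_root (@circ_sym _ _) _.
rewrite /lee_ev (bigD1 _ rr) /= [in RHS](bigD1 _ rr) /= mulrA; congr (_ * _).
  rewrite -(labelling_circle kv dr) -(labelling_circle lv dr).
  rewrite -(labelling_circle (set_circleP d lv) dr) ffunE /same_circle connect0.
  by rewrite /lee_val (negPf ld) mulr1.
apply: eq_bigr => e /andP[re ne]; rewrite ffunE.
by case E: (same_circle v d e) => //; move: ne; rewrite -roots_circle re E.
Qed.

(** Multiplication by X on the circle of [d], with X^2 = hX when that circle already carries X. *)
Lemma mulX_exists d z : exists z', forall v k, labelling v k ->
  coord v k z' = (if k d then h else 0) * coord v k z.
Proof.
pose sg (s : gen L) : gen L := exist (fun s => labelling s.1 s.2)
  ((val s).1, set_circle (val s).1 d (val s).2) (set_circleP d (valP s)).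
exists (\sum_s z s *: (if (val s).2 d then h *: delta_gen s else delta_gen (sg s))).
move=> v k kv; rewrite {2}(CKh_delta z) !coord_sum mulr_sumr.
apply: eq_bigr => s _; rewrite !coordZ mulrCA; congr (_ * _).
case: ifP => sd.
  rewrite coordZ coord_delta.
  case: (_ =P v) => [E|]; last by rewrite !mul0r !mulr0.
  rewrite !mul1r; case: ifP => // /negbT kd.
  by rewrite (lee_ev_eq0 kv _ sd kd) ?mulr0 // -E; apply: (valP s).
apply: etrans (coord_delta v k (sg s)) _; rewrite (coord_delta v k s).
change (((val s).1 == v)%:R * lee_ev v k (set_circle (val s).1 d (val s).2) =
  (if k d then h else 0) * (((val s).1 == v)%:R * lee_ev v k (val s).2)).
case: (_ =P v) => [E|]; last by rewrite !mul0r !mulr0.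
rewrite !mul1r E lee_ev_set_circle ?sd // -E; exact: (valP s).
Qed.

(** Each condition [k d = true] is imposed by multiplying by X, each [k d = false] by multiplying by
    X + h. Every condition costs one factor [h]; surplus powers are put on the generator with all
    labels 1. *)
Lemma realize v (ds : seq (dart L)) (lam : dart L -> bool) n :
  (size ds <= n)%N -> exists z, forall w k, labelling w k -> coord w k z =
    (w == v)%:R * (h ^+ n * (all (fun d => k d == lam d) ds)%:R).
Proof.
elim: ds n => [|d ds IHds] n /=.
  have l0 : labelling v [ffun=> false].
    by apply/labellingP; split=> d; rewrite !ffunE.
  move=> _; pose s : gen L := exist (fun s => labelling s.1 s.2) (v, _) l0.
  exists (h ^+ n *: delta_gen s) => w k _; rewrite coordZ coord_delta /=.
  rewrite /lee_ev big1 ?mulr1 => [|d _]; last by rewrite ffunE.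
  by rewrite eq_sym mulrC.
case: n => // n /IHds[z Hz]; have [z' Hz'] := mulX_exists d z.
exists (if lam d then z' else h *: z + z') => w k kw.
rewrite (fun_if (coord w k)) coordD coordZ Hz' // Hz // exprS.
set A := (_ == v)%:R; set B := h ^+ n; move: h A B => q A B.
have qq := addRR (q * (A * (B * (all (fun e => k e == lam e) ds)%:R))).
case: (lam d); case: (k d) => /=; rewrite ?mul0r ?mulr0 ?addr0 ?qq //.
  by rewrite !mulrA (mulrC q).
by rewrite !mulrA (mulrC q).
Qed.

Lemma dvd_sum (I : finType) (P : pred I) (F : I -> R) (q : R) :
  (forall i, exists a, F i = q * a) -> exists a, \sum_(i | P i) F i = q * a.
Proof.
move=> H; elim/big_ind: _ => //.
  by exists 0; rewrite mulr0.
by move=> _ _ [a ->] [b ->]; exists (a + b); rewrite mulrDr.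
Qed.

(* In characteristic 2, flipping the labels of a union of circles on which no
   generator has the label X pairs off the terms of the sum. *)
Lemma dvd_sum_coord v (Q : pred {ffun dart L -> bool}) (F : finType)
    (K : F -> {ffun dart L -> bool}) z :
  (forall f, labelling v (K f)) -> (forall f, exists d, K f d) ->
  (forall f g d, K f d -> K g d -> f = g) ->
  (forall f k, labelling v k -> Q k -> Q [ffun d => k d (+) K f d]) ->
  exists a, \sum_(k | labelling v k && Q k) coord v k z = h ^+ #|F| * a.
Proof.
move=> lK neK djK QK.
suff H (s : gen L) : exists a, \sum_(k | labelling v k && Q k)
    ((val s).1 == v)%:R * lee_ev v k (val s).2 = h ^+ #|F| * a.
  rewrite (eq_bigr (fun k => \sum_s z s * coord v k (delta_gen s))); last first.
    move=> k _; rewrite {1}(CKh_delta z) coord_sum.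
    by apply: eq_bigr => s _; rewrite coordZ.
  rewrite exchange_big /=; apply: dvd_sum => s; have [a Ha] := H s.
  exists (z s * a); rewrite mulrCA -Ha mulr_sumr; apply: eq_bigr => k _.
  by rewrite coord_delta.
case: eqP => [sv|_]; last by exists 0; rewrite mulr0 big1 // => k _; rewrite mul0r.
have ls : labelling v (val s).2 by rewrite -sv; apply: (valP s).
move: (val s).2 ls => l lv {s sv}.
have [/existsP[f /forallP fl]|] := boolP [exists f, [forall d, ~~ (K f d && l d)]].
  exists 0; rewrite mulr0.
  pose flip k : {ffun dart L -> bool} := [ffun d => k d (+) K f d].
  have flipK : involutive flip.
    by move=> k; apply/ffunP=> d; rewrite !ffunE addbK.
  have flipP k : labelling v k -> labelling v (flip k).
    have [A B] := labellingP _ _ (lK f).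
    move=> /labellingP[A' B']; apply/labellingP; split=> d; rewrite !ffunE.
      by rewrite A A'.
    by rewrite B B'.
  have [d0 Kd0] := neK f.
  rewrite (bigID (fun k : {ffun dart L -> bool} => k d0)) /=.
  rewrite [X in _ + X](reindex_inj (inv_inj flipK)) /=.
  rewrite [X in _ + X](eq_bigl (fun k => labelling v k && Q k && k d0)).
    rewrite [X in _ + X](eq_bigr (fun k => 1 * lee_ev v k l)) ?addRR // => k _.
    congr (_ * _); apply: eq_bigr => d _; rewrite ffunE.
    have := fl d; case: (K f d) => /=; last by rewrite addbF.
    by move/negPf->.
  move=> k; rewrite ffunE Kd0 addbT negbK; congr (_ && _).
  apply/andP/andP => -[A B]; last by split; [apply: flipP|apply: QK].
  split; first by rewrite -(flipK k); apply: flipP.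
  by rewrite -(flipK k); apply: QK.
(* Now each family [K f] contains a circle labelled X. The families are disjoint, so these are
   [#|F|] different circles, each contributing a factor [h] or 0. *)
move=> /existsPn nf.
have ex f : exists d, roots (circ_rel v) d && (K f d && l d).
  have /forallPn[d] := nf f; rewrite negbK => /andP[Kd ld].
  have dr := circle_root v d; exists (fingraph.root (circ_rel v) d).
  rewrite -(labelling_circle (lK f) dr) -(labelling_circle lv dr) Kd ld !andbT.
  exact: roots_root (@circ_sym _ _) _.
pose r f := xchoose (ex f).
have rP f : roots (circ_rel v) (r f) /\ K f (r f) /\ l (r f).
  by have /and3P[A B C] := xchooseP (ex f).
have rI : injective r.
  move=> f g E; have [_ [A _]] := rP f; have [_ [B _]] := rP g.
  by apply: (djK _ _ (r f)); rewrite // E.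
have ev_h k : exists a, lee_ev v k l = h ^+ #|F| * a.
  rewrite /lee_ev (bigID (mem (codom r))) /=.
  rewrite (eq_bigl (fun d => d \in codom r)) => [|d]; last first.
    by rewrite andb_idl // => /codomP[f ->]; have [] := rP f.
  have cu : uniq (codom r) by rewrite map_inj_uniq ?enum_uniq.
  rewrite -(big_uniq _ cu) big_image /=.
  have [a ->] : exists a, \prod_f lee_val (l (r f)) (k (r f)) = h ^+ #|F| * a;
    last first.
    by eexists; rewrite -mulrA.
  exists (\prod_f (if k (r f) then 1 else 0)).
  rewrite -prodr_const -big_split /=; apply: eq_bigr => f _.
  by have [_ [_ ->]] := rP f; rewrite /lee_val; case: ifP; rewrite ?mulr1 ?mulr0.
by apply: dvd_sum => k; rewrite mul1r.
Qed.

(** Distributivity expands the product over functions supported on the roots; such a function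
    becomes a labelling when each dart takes the value at its root. *)
Lemma coord_pure v (f : dart L -> bool -> R) k : labelling v k ->
  coord v k [ffun s : gen L => if (val s).1 == v
    then \prod_(d | roots (circ_rel v) d) f d ((val s).2 d) else 0] =
  \prod_(d | roots (circ_rel v) d) \sum_b f d b * lee_val b (k d).
Proof.
move=> kv; rewrite (big_distr_big false) /coord.
pose u (g : {ffun dart L -> bool}) : {ffun dart L -> bool} :=
  [ffun d => g (fingraph.root (circ_rel v) d)].
have uP g : labelling v (u g).
  have E a b : same_circle v a b ->
      fingraph.root (circ_rel v) a = fingraph.root (circ_rel v) b.
    by move=> ab; apply/eqP; rewrite (root_connect (@circ_sym _ _)).
  apply/labellingP; split=> d; rewrite !ffunE; congr (g _); apply: E;
    by rewrite same_circle_sym ?same_circle_edge ?same_circle_smooth.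
pose w (g : {ffun dart L -> bool}) : gen L :=
  exist (fun s => labelling s.1 s.2) (v, u g) (uP g).
pose w' (t : gen L) : {ffun dart L -> bool} :=
  [ffun d => roots (circ_rel v) d && (val t).2 d].
rewrite (reindex_onto w w') /=; last first.
  move=> t /eqP tv; apply/val_inj; rewrite [RHS]surjective_pairing tv; congr (_, _).
  apply/ffunP=> d; rewrite !ffunE roots_root ?andTb; last exact: circ_sym.
  apply/esym; apply: (@labelling_circle _ v) (circle_root v d).
  by rewrite -tv; apply: (valP t).
apply: eq_big => g.
  rewrite eqxx /=; apply/eqP/pffun_onP => [<-|[/subsetP gr _]].
    split=> //; apply/subsetP=> d; rewrite inE ffunE -[in_mem _ _]/(roots
      (circ_rel v) d).
    by case: (roots _ d).
  apply/ffunP=> d; rewrite !ffunE /=.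
  case rd: (roots (circ_rel v) d); first by rewrite (eqP rd).
  by apply/esym/negP=> gd; have := gr d; rewrite inE gd => /(_ isT);
    rewrite -[in_mem _ _]/(roots (circ_rel v) d) rd.
move=> _; rewrite ffunE /= eqxx /lee_ev -big_split; apply: eq_bigr => d rd /=.
by rewrite ffunE (eqP rd).
Qed.

End Differential.

(** * Linearity of the differential and the coordinates of the Lee cycle *)

Section LeeCycle.
Variable L : diagram.
Implicit Types (v : vertex L) (k : {ffun dart L -> bool}) (z : CKh L).

Lemma dKhD z z' : dKh (z + z') = dKh z + dKh z'.
Proof.
apply/ffunP=> t; rewrite [RHS]ffunE !dKhE -big_split; apply: eq_bigr => s _.
by rewrite ffunE mulrDl.
Qed.

Lemma dKhZ (a : R) z : dKh (a *: z) = a *: dKh z.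
Proof.
apply/ffunP=> t; rewrite [RHS]ffunE !dKhE.
transitivity (a * \sum_s z s * \sum_c dcoef_at c s t) => //.
rewrite mulr_sumr; apply: eq_bigr => s _; rewrite mulrA; congr (_ * _).
exact: ffunE.
Qed.

Lemma dKh0 : dKh (0 : CKh L) = 0.
Proof. by rewrite -(scale0r 0) dKhZ !scale0r. Qed.

Lemma CKh_addrr z : z + z = 0.
Proof. by apply/ffunP=> t; rewrite !ffunE addRR. Qed.

Lemma CKh_oppr z : - z = z.
Proof. by apply: (addIr z); rewrite addNr CKh_addrr. Qed.

Lemma leecoef_lee_val (a b : bool) :
  \sum_c leecoef a c * lee_val c b = h * (b == a)%:R.
Proof.
rewrite big_bool /leecoef /lee_val opprR; have := addRR h; move: h => q qq.
by case: a; case: b; rewrite /= ?mul1r ?mul0r ?mulr1 ?mulr0 ?addr0 ?add0r.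
Qed.

Lemma coord_lee v k : labelling v k -> coord v k (lee L) =
  (v == seifert L)%:R *
    (h ^+ ncircles (seifert L) * [forall d, k d == leeX d]%:R).
Proof.
move=> kv; case: eqP => [E|/eqP vS]; last first.
  rewrite mul0r /coord big1 // => t /eqP tv; rewrite ffunE tv (negPf vS).
  exact: mul0r.
rewrite mul1r; subst v.
rewrite [LHS](coord_pure (fun d b => leecoef (leeX d) b) kv).
under eq_bigr => d _ do rewrite leecoef_lee_val.
rewrite big_split /=; congr (_ * _).
  rewrite prodr_const; congr (_ ^+ _); apply: eq_card => d.
  by rewrite !inE andbT.
have [/forallP A|/forallPn[d nd]] := boolP [forall d, k d == leeX d].
  by apply: big1 => d _; rewrite A.
rewrite (bigD1 (fingraph.root (circ_rel (seifert L)) d)) /=; last first.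
  exact: roots_root (@circ_sym _ _) _.
have dr := circle_root (seifert L) d.
rewrite -(labelling_circle kv dr) -(@leeX_circle _ d) //.
by rewrite (negPf nd) mul0r.
Qed.

End LeeCycle.

(** * The involution in Lee coordinates *)

Section Involution.
Variable L : si_diagram.
Implicit Types (v : vertex L) (k : {ffun dart L -> bool}) (z : CKh L).

Lemma si_tauCK : involutive (@si_tauC L).
Proof.
move=> c; rewrite -[X in si_tauC X](si_tau_fst (c, 0)) -si_tau_fst.
by rewrite si_tauK.
Qed.

Lemma tau_vertexK : involutive (@tau_vertex L).
Proof. by move=> v; apply/ffunP=> c; rewrite !ffunE si_tauCK. Qed.

Lemma tau_labelK : involutive (@tau_label L).
Proof. by move=> k; apply/ffunP=> d; rewrite !ffunE si_tauK. Qed.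

Lemma tau_genK : involutive (@tau_gen L).
Proof.
move=> s; apply/val_inj; rewrite /= tau_vertexK tau_labelK.
exact/esym/surjective_pairing.
Qed.

Lemma same_circle_tau v d d' :
  same_circle v d d' -> same_circle (tau_vertex v) (si_tau d) (si_tau d').
Proof.
move=> H; apply: (circle_ind
  (P := fun e => same_circle (tau_vertex v) (si_tau d) (si_tau e))) H _.
- by move=> e /same_circle_trans; apply; rewrite si_tau_edge same_circle_edge.
- move=> e /same_circle_trans; apply.
  have := tau_smooth (tau_vertex v) e; rewrite tau_vertexK => ->;
    exact: same_circle_smooth.
exact: connect0.
Qed.

(** [si_tau] need not send chosen representatives to chosen representatives; sending a root to the
    root of its image is the bijection used to reindex. *)
Lemma prod_roots_tau v (F : dart L -> R) :
  (forall d d', same_circle v d d' -> F d = F d') ->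
  \prod_(d | roots (circ_rel v) d) F d =
  \prod_(d | roots (circ_rel (tau_vertex v)) d) F (si_tau d).
Proof.
move=> HF; pose r w := fingraph.root (@circ_rel L w).
have rr w d : roots (circ_rel w) (r w d) by apply: roots_root (@circ_sym _ _) _.
have rE w d : roots (circ_rel w) d -> r w d = d by move/eqP.
have rc w a b : same_circle w a b -> r w a = r w b.
  by move=> ab; apply/eqP; rewrite (root_connect (@circ_sym _ _)).
pose g w d := r w (si_tau d : dart L).
have gK w d : g w (g (tau_vertex w) d) = r w d.
  rewrite /g; apply: rc; rewrite -{2}(si_tauK d) -{1}(tau_vertexK w).
  apply: same_circle_tau; rewrite same_circle_sym; exact: circle_root.
rewrite (reindex_onto (g v) (g (tau_vertex v))) /=; last first.
  by move=> d dr; rewrite gK rE.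
apply: eq_big => d.
  rewrite /g rr /=; have := gK (tau_vertex v) d.
  rewrite tau_vertexK /g => ->; apply/eqP/idP => [<-|/rE //].
  exact: rr.
by move=> _; apply: HF; rewrite same_circle_sym; apply: circle_root.
Qed.

Lemma coord_tau v k z : labelling v k ->
  coord v k (tauKh z) = coord (tau_vertex v) (tau_label k) z.
Proof.
move=> kv; rewrite /coord (reindex_inj (inv_inj tau_genK)) /=.
apply: eq_big => s; first by rewrite (inv_eq tau_vertexK).
move/eqP=> sv; rewrite ffunE tau_genK; congr (_ * _).
rewrite /lee_ev prod_roots_tau => [|d d' dd]; last first.
  apply: lee_ev_const dd => //; rewrite -sv; apply: tau_labelling; exact: (valP s).
by apply: eq_bigr => d _; rewrite !ffunE si_tauK.
Qed.

Lemma tauKhD z z' : tauKh (z + z') = tauKh z + tauKh z'.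
Proof. by apply/ffunP=> s; rewrite !ffunE. Qed.

Lemma tauKhZ (a : R) z : tauKh (a *: z) = a *: tauKh z.
Proof. by apply/ffunP=> s; rewrite !ffunE. Qed.

Lemma tauKh0 : tauKh (0 : CKh L) = 0.
Proof. by apply/ffunP=> s; rewrite !ffunE. Qed.

End Involution.

(* As R is a domain, phi vanishes on the torsion classes. *)
Lemma divisible_bound (M : lmodType R) (d : M -> M) (phi : M -> R) z k n m :
  (forall a x, phi (a *: x) = a * phi x) ->
  (forall x y, phi (x - y) = phi x - phi y) ->
  (forall x, phi (d x) = 0) -> (forall x, exists a, phi x = h ^+ m * a) ->
  phi z = h ^+ (n + m) -> divisible d k z -> (k <= n)%N.
Proof.
move=> phiZ phiB phid phim phiz [w _ [a a0 [b Eb]]].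
have := phid b; rewrite -Eb phiZ phiB phiZ => /eqP.
rewrite mulf_eq0 (negPf a0) /= subr_eq0 phiz; have [c ->] := phim w.
rewrite exprD [_ * h ^+ m]mulrC mulrCA => /eqP/(mulfI (h_neq0 m)).
rewrite leqNgt => E; apply/negP=> nk; move: E.
(* If [n < k], cancelling the powers of [h] makes 1 a multiple of [h], which is refuted by
   evaluation at 0. *)
rewrite -(subnKC nk) addSnnS exprD -mulrA -[LHS]mulr1 => /(mulfI (h_neq0 n)).
move/(congr1 (fun q : {poly 'F_2} => q.[0])).
by rewrite exprS -mulrA hornerM hornerX mul0r hornerC => /eqP; rewrite oner_eq0.
Qed.

Section DifferentialAt.
Variable L : diagram.
Hypothesis edge_odd :
  forall d : dart L, odd (val (dg_edge d).2) = ~~ odd (val d.2).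
Implicit Types (v w : vertex L) (k : {ffun dart L -> bool}).

Lemma coord_d_at v (f : {ffun dart L -> bool} -> R) z :
  (forall w k, labelling w k -> coord w k z = (w == v)%:R * f k) ->
  forall w k, labelling w k -> coord w k (dKh z) =
    \sum_(c | ~~ v c && (w == addc v c))
      (k (c, 0) == k (c, 2%:R))%:R * (edge_coef v c * f k).
Proof.
move=> Hz w k kw; rewrite coord_d // big_mkcond [RHS]big_mkcond.
apply: eq_bigr => c _; case: ifP => wc; last first.
  case: ifP => // /andP[_ /eqP E].
  by move: wc; rewrite E ffunE eqxx.
have [E|nE] := eqVneq (k (c, 0)) (k (c, 2%:R)); last by rewrite !mul0r if_same.
rewrite !mul1r Hz; last first.
  by apply: (labelling_transfer (c := c) _ E kw) => b nb; rewrite ffunE nb.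
have -> : (subc w c == v) = ~~ v c && (w == addc v c).
  apply/eqP/andP => [<-|[vc /eqP->]]; last exact: addcK.
  by rewrite subcK // eqxx ffunE eqxx.
case: ifP; last by rewrite mul0r mulr0.
by case/andP=> vc /eqP->; rewrite addcK // mul1r.
Qed.

End DifferentialAt.

(** * Sums modulo 2, counting of circles, and divisibility in the mapping cone *)

Lemma Z3_case (P : 'Z_3 -> Prop) : P 0 -> P 1 -> P 2%:R -> forall c, P c.
Proof.
move=> P0 P1 P2 [[|[|[|]]] // i].
- by rewrite (_ : Ordinal _ = 0) //; apply/val_inj.
- by rewrite (_ : Ordinal _ = 1) //; apply/val_inj.
- by rewrite (_ : Ordinal _ = 2%:R) //; apply/val_inj.
Qed.

Lemma Z4_21 : 2%:R + 1 = 3%:R :> 'Z_4. Proof. exact/val_inj. Qed.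
Lemma Z4_m1 : - 1 = 3%:R :> 'Z_4. Proof. exact/val_inj. Qed.
Lemma Z4_2m1 : 2%:R - 1 = 1 :> 'Z_4. Proof. exact/val_inj. Qed.

(** Modulo 2 the indicator of equality of two bits is 1 plus their sum, so the sum telescopes. *)
Lemma sum_eq_succ (x : nat -> bool) n :
  \sum_(r < n) (x r == x r.+1)%:R = n%:R + (x 0)%:R + (x n)%:R :> R.
Proof.
elim: n => [|n IHn]; first by rewrite big_ord0 add0r addRR.
rewrite big_ord_recr /= {}IHn [in RHS]mulrSr -!addrA; congr (_ + _).
rewrite [RHS]addrCA; congr (_ + _).
by case: (x n); case: (x n.+1); rewrite /= ?addr0 ?add0r ?addRR.
Qed.

Lemma natr_odd n : odd n -> n%:R = 1 :> R.
Proof.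
move=> o; rewrite -[n]odd_double_half o natrD -addnn natrD addRR.
exact: addr0.
Qed.

Lemma dKh_sum (L : diagram) (I : finType) (P : pred I) (f : I -> CKh L) :
  dKh (\sum_(i | P i) f i) = \sum_(i | P i) dKh (f i).
Proof. exact: (big_morph _ (@dKhD L) (@dKh0 L)). Qed.

Lemma tauKh_sum (L : si_diagram) (I : finType) (P : pred I) (f : I -> CKh L) :
  tauKh (\sum_(i | P i) f i) = \sum_(i | P i) tauKh (f i).
Proof. exact: (big_morph _ (@tauKhD L) (@tauKh0 L)). Qed.

Lemma rot_odd (C : finType) (d : C * 'Z_4) :
  odd (val (rot d).2) = ~~ odd (val d.2).
Proof. exact: Z4_val. Qed.

Lemma rotV_odd (C : finType) (d : C * 'Z_4) :
  odd (val (rotV d).2) = ~~ odd (val d.2).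
Proof. exact: Z4_valV. Qed.

Lemma n_comp_classify (T F : finType) (e : rel T) (cl : T -> F) (rep : F -> T) :
  connect_sym e -> (forall x y, e x y -> cl x = cl y) -> cancel rep cl ->
  (forall x, connect e (rep (cl x)) x) -> n_comp e {: T} = #|F|.
Proof.
move=> sC cle repK clC.
have clI x y : connect e x y -> cl x = cl y.
  by case/connectP=> q; elim: q x => [|z q IHq] x /=;
    [move=> _ -> | case/andP=> /cle-> /IHq H /H].
rewrite -(card_codom (can_inj repK)) /n_comp_mem.
have <- : #|[seq fingraph.root e x | x in codom rep]| = #|codom rep|.
  apply: card_in_image => _ _ /codomP[a ->] /codomP[b ->] /eqP.
  by rewrite (root_connect sC) => /clI; rewrite !repK => ->.
apply: eq_card => x; rewrite !inE andbT; apply/idP/imageP=> [/eqP rx|[y _ ->]].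
  exists (rep (cl x)); first exact: codom_f.
  by apply/esym; rewrite -[RHS]rx; apply/eqP; rewrite (root_connect sC).
exact: roots_root.
Qed.

(** The indicator of the circle of [x] is itself a labelling. *)
Lemma same_circle_labels (L : diagram) (v : vertex L) x y :
  (forall k, labelling v k -> k x = k y) -> same_circle v x y.
Proof.
move=> H; pose k : {ffun dart L -> bool} := set_circle v x [ffun=> false].
have kv : labelling v k.
  by apply: set_circleP; apply/labellingP; split=> d; rewrite !ffunE.
by have := H k kv; rewrite !ffunE /= !orbF {1}/same_circle connect0 => <-.
Qed.

Lemma telescope_pchar2 (x : nat -> R) n :
  \sum_(r < n) (x r + x r.+1) = x 0%N + x n.
Proof.
elim: n => [|n IHn]; first by rewrite big_ord0 addRR.
by rewrite big_ord_recr /= IHn -addrA (addrA (x n)) addRR add0r.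
Qed.

Lemma dKhI_cycle (L : si_diagram) (x y : CKh L) :
  dKh x = 0 -> x - tauKh x - dKh y = 0 -> is_cycle (@dKhI L) (x, y).
Proof. by rewrite /is_cycle /dKhI /= => -> ->. Qed.

(** The difference between [(x, y)] and [h ^+ n *: (x', y')] is the boundary of [(e, b)] in the
    cone. *)
Lemma dKhI_divisible (L : si_diagram) n (x y x' y' e b : CKh L) :
  dKh x' = 0 -> x' - tauKh x' - dKh y' = 0 ->
  x = h ^+ n *: x' + dKh e -> y = h ^+ n *: y' + (e - tauKh e - dKh b) ->
  divisible (@dKhI L) n (x, y).
Proof.
move=> dx dy -> ->; exists (x', y'); first exact: dKhI_cycle.
exists 1; first exact: oner_neq0.
exists (e, b); rewrite scale1r.
by apply: injective_projections; rewrite /= addrC addKr.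
Qed.

(** * Labellings of the pretzel diagram by levels *)

Section Pretzel.
Variables (p : nat) (p_gt0 : (0 < p)%N).
Hypotheses (p_odd : odd p) (p_ge3 : (3 <= p)%N).
Notation K := (pretzel p_gt0).
Notation pd := (pdart p).
Notation bot := (row_bot p_gt0).
Notation top := (row_top p_gt0).
Implicit Types (c : 'Z_3) (r s : 'I_p) (v : vertex K) (k : {ffun dart K -> bool}).
Implicit Types (J : {set 'I_p}).

Lemma pretzel_edge_odd (d : dart K) : odd (val (dg_edge d).2) = ~~ odd (val d.2).
Proof. by case: d => [[c r] i]; elim/Z4P: i => /=; case: ifP. Qed.

(* The level j of a column lies between its rows j - 1 and j (level 0 is the top
   and level p the bottom); e and w give the labels of the two strands of each
   column at each level, on the east and on the west side. *)
Definition level_lab (e w : 'Z_3 -> nat -> bool) : {ffun dart K -> bool} :=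
  [ffun d : pd => match val d.2 with
    | 0 => e d.1.1 d.1.2 | 1 => w d.1.1 d.1.2
    | 2 => w d.1.1 d.1.2.+1 | _ => e d.1.1 d.1.2.+1 end].

(* The smoothing at (c, r) is the one of the Seifert resolution. *)
Definition cut v c r : bool := v (c, r) == (c == 1).

(** Gluing conditions along the top arcs, along the bottom arcs and at the crossings. A cut crossing
    joins the two strands at the level above it and at the level below it; any other crossing lets
    both strands pass. *)
Definition lvl_ok v (e w : 'Z_3 -> nat -> bool) : Prop :=
  [/\ forall c, e c 0%N = w (c + 1) 0%N, forall c, e c p = w (c + 1) p &
      forall c r, if cut v c r then e c r = w c r /\ e c r.+1 = w c r.+1
                  else e c r = e c r.+1 /\ w c r = w c r.+1].

Lemma smooth_cut v c r i : smooth v ((c, r), i) =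
  if odd (val i) (+) ~~ cut v c r then ((c, r), i - 1) else ((c, r), i + 1) :> pd.
Proof.
rewrite /smooth /rot /rotV /cut /= /pover /=.
by case: (odd _); case: (c == 1); case: (v (c, r)).
Qed.

Lemma level_labP v e w : lvl_ok v e w -> labelling v (level_lab e w).
Proof.
case=> Ht Hb Hr; apply/labellingP; split=> -[[c r] i].
  have EP := @ord_pred_val p r; have ES := @ordS_val p r; rewrite /= in EP ES.
  rewrite !ffunE; elim/Z4P: i => /=; case: ifP => [/eqP E|/negbT E] /=.
  - by rewrite E Ht.
  - by rewrite EP // prednK // lt0n.
  - by rewrite E Ht subrK.
  - by rewrite EP // prednK // lt0n.
  - by rewrite E Hb subrK.
  - by rewrite ES.
  - by rewrite E Hb.
  - by rewrite ES.
rewrite smooth_cut !ffunE; have := Hr c r.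
by elim/Z4P: i => /=; case: (cut v c r) => /= -[].
Qed.

Definition row (j : nat) : 'I_p := insubd top j.

Lemma rowE r : row r = r.
Proof. by apply/val_inj; rewrite val_insubd ltn_ord. Qed.

Lemma val_row j : (j < p)%N -> val (row j) = j.
Proof. by move=> jp; rewrite val_insubd jp. Qed.

(** Levels below [p] are read at the upper darts of a row, level [p] at the lower darts of the
    bottom row. *)
Definition east k c j : bool :=
  if (j < p)%N then k ((c, row j), 0) else k ((c, bot), 3%:R).
Definition west k c j : bool :=
  if (j < p)%N then k ((c, row j), 1) else k ((c, bot), 2%:R).

Lemma labelling_level v k c r : labelling v k ->
  [/\ k ((c, r), 0) = east k c r, k ((c, r), 1) = west k c r,
      k ((c, r), 2%:R) = west k c r.+1 & k ((c, r), 3%:R) = east k c r.+1].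
Proof.
case/labellingP=> He _; rewrite /east /west ltn_ord rowE; split=> //.
  have := He ((c, r), 2%:R); rewrite /= -/(pdart p).
  have ES := @ordS_val p r; rewrite /= in ES.
  case: eqP => [E _|/eqP E <-]; first by rewrite E ltnn; congr (k (_, _, _));
    apply/eqP; rewrite -row_botE E.
  rewrite ltn_neqAle E ltn_ord; congr (k (_, _, _)); apply/val_inj.
  by rewrite /= ES // val_row // ltn_neqAle E ltn_ord.
have := He ((c, r), 3%:R); rewrite /= -/(pdart p).
have ES := @ordS_val p r; rewrite /= in ES.
case: eqP => [E _|/eqP E <-]; first by rewrite E ltnn; congr (k (_, _, _));
  apply/eqP; rewrite -row_botE E.
rewrite ltn_neqAle E ltn_ord; congr (k (_, _, _)); apply/val_inj.
by rewrite /= ES // val_row // ltn_neqAle E ltn_ord.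
Qed.

Lemma labelling_levels v k : labelling v k -> lvl_ok v (east k) (west k).
Proof.
move=> kv; have [He Hs] := labellingP _ _ kv; split=> c.
- have := He ((c, top), 0); rewrite /= => E.
  by have [<- _ _ _] := labelling_level c top kv;
    have [_ <- _ _] := labelling_level (c + 1) top kv.
- have := He ((c, bot), 3%:R); rewrite /= prednK // eqxx => E.
  have [_ _ _] := labelling_level c bot kv;
    have [_ _ + _] := labelling_level (c + 1) bot kv.
  by rewrite /= prednK // => <- <-.
move=> r; have [E0 E1 E2 E3] := labelling_level c r kv.
have A := Hs ((c, r), 0); have B := Hs ((c, r), 2%:R).
rewrite smooth_cut /= in A; rewrite smooth_cut /= in B.
case: (cut v c r) A B => /=.
  rewrite add0r [2%:R + 1]Z4_21 => A B.
  by rewrite -E0 -E1 -E2 -E3; split.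
rewrite add0r Z4_2m1 Z4_m1 => A B.
by rewrite -E0 -E1 -E2 -E3; split.
Qed.

(** The colouring is true exactly on the levels of the column between the two cut rows. *)
Lemma separated v c0 r s : r != s -> cut v c0 r -> cut v c0 s ->
  exists2 k, labelling v k & k ((c0, r), 0) != k ((c0, r), 2%:R).
Proof.
move=> rs cr cs; have rp := ltn_ord r; have sp := ltn_ord s.
have nrs : (r : nat) != s by [].
pose e c j := (c == c0) && (minn r s < j <= maxn r s)%N.
exists (level_lab e e); last first.
  rewrite !ffunE /= /e eqxx /= /minn /maxn.
  by case: (ltngtP r s) nrs => //; lia.
apply: level_labP; split=> c; rewrite /e.
- by rewrite !ltn0 !andbF.
- by rewrite (_ : (_ < p <= _)%N = false) ?andbF //; lia.
move=> t; case: ifP => // ct.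
case: eqP => [E|] //=; split.
all: have nrt : (t : nat) != r by apply: contraFneq ct => /val_inj->; rewrite E.
all: have nst : (t : nat) != s by apply: contraFneq ct => /val_inj->; rewrite E.
all: lia.
Qed.

Lemma edge_coef_cut v c0 r s : r != s -> cut v c0 r -> cut v c0 s ->
  edge_coef v (c0, r) = 1.
Proof. by move=> rs cr cs; have [k kv] := separated rs cr cs;
  apply: edge_coef_merge. Qed.

Lemma edge_coef_uncut v c0 r s : ~~ v (c0, r) -> r != s ->
  cut (addc v (c0, r)) c0 r -> cut (addc v (c0, r)) c0 s -> edge_coef v (c0, r) = h.
Proof.
move=> vc rs cr cs; have [k kv] := separated rs cr cs.
by apply: (edge_coef_split pretzel_edge_odd vc).
Qed.

(** * Explicit cycles *)

(** The label of the Lee cycle, by [leeX_lam]: X at even levels and Y at odd ones. The top circle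
    thus carries X and, as [p] is odd, the bottom circle Y. *)
Definition lam (d : dart K) : bool := ~~ odd (val d.1.2 + (1 < val d.2)).

Definition dT : dart K := ((1, top), 0).
Definition dB : dart K := ((1, bot), 2%:R).
(* One dart on each inner circle of the outer columns. *)
Definition outs : seq (dart K) :=
  [seq ((c, r), 2%:R) | c <- [:: 0; 2%:R], r <- [seq r <- enum 'I_p | r != bot]].

Lemma size_outs : size outs = (2 * p.-1)%N.
Proof.
rewrite size_allpairs size_filter; congr (_ * _)%N.
rewrite (eq_count (a2 := predC (pred1 bot))) //.
have := count_predC (pred1 bot) (enum 'I_p).
rewrite count_uniq_mem ?enum_uniq // mem_enum size_enum_ord /=; lia.
Qed.

Definition lee_outside k : bool := all (fun d => k d == lam d) (dT :: outs).

Lemma lee_outside_top k : lee_outside k -> k dT.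
Proof. by case/andP=> /eqP->. Qed.

Lemma lee_outsideP k : lee_outside k <-> k dT /\ forall c r, c != 1 -> r != bot ->
  k ((c, r), 2%:R) = ~~ odd r.+1.
Proof.
rewrite /lee_outside /= -[lam dT]/true eqb_id; split.
  case/andP=> -> /allP H; split=> // c r c1 rb.
  have /H/eqP-> : ((c, r), 2%:R) \in outs; last by rewrite /lam /= addn1.
  apply/allpairsP; exists (c, r); split=> //=;
    last by rewrite mem_filter rb mem_enum.
  by move: c1; elim/Z3_case: c.
case=> -> H; apply/allP=> d /allpairsP[[c r] /= [c02]].
rewrite mem_filter => /andP[rb _] ->; rewrite H // ?/lam /= ?addn1 //.
by move: c02; elim/Z3_case: c {H}.
Qed.

(* The Seifert resolution with the bottom crossing of the left (a) and right (b)
   column and the central crossing in row o smoothed the other way. *)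
Definition smod (a b : bool) (o : option 'I_p) : vertex K :=
  [ffun c : pcrossing p => if c.1 == 1 then o != Some c.2
     else (if c.1 == 0 then a else b) && (c.2 == bot)].

Lemma cut_smod a b o c r : cut (smod a b o) c r =
  if c == 1 then o != Some r else ~~ ((if c == 0 then a else b) && (r == bot)).
Proof. by rewrite /cut ffunE /=; case: (c == 1) => //; rewrite eqbF_neg. Qed.

Lemma tau_smod a b o : tau_vertex (smod a b o) = smod b a o.
Proof.
apply/ffunP=> -[c r]; rewrite ffunE ffunE [RHS]ffunE /=.
by elim/Z3_case: c.
Qed.

Lemma top_neq_bot : top != bot.
Proof. by rewrite -row_botE /=; lia. Qed.

Lemma smod_levels a b o k c r : labelling (smod a b o) k -> c != 1 -> r != bot ->
  east k c r = west k c r /\ east k c r.+1 = west k c r.+1.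
Proof.
move=> kv /negPf c1 /negPf rb; have [_ _ /(_ c r)] := labelling_levels kv.
by rewrite cut_smod c1 rb andbF.
Qed.

Lemma smod_top a b o k c : labelling (smod a b o) k ->
  east k c 0 = east k 1 0 /\ west k c 0 = east k 1 0.
Proof.
move=> kv; have [Ht _ _] := labelling_levels kv.
have [A _] := smod_levels kv (c := 0) isT top_neq_bot.
have [B _] := smod_levels kv (c := 2%:R) isT top_neq_bot.
have := Ht 0; have := Ht 1; have := Ht 2%:R; move: A B => /= A B.
rewrite (_ : 2%:R + 1 = 0 :> 'Z_3); last exact/val_inj.
rewrite add0r (_ : 1 + 1 = 2%:R :> 'Z_3) // => E2 E1 E0.
by elim/Z3_case: c; rewrite -?E0 ?A -?E2 ?B -?E1.
Qed.

Lemma k_dT a b o k : labelling (smod a b o) k -> k dT = east k 1 0.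
Proof. by move=> kv; have [-> _ _ _] := labelling_level 1 top kv. Qed.

Lemma lee_outside_east a b o k c r : labelling (smod a b o) k -> lee_outside k ->
  c != 1 ->
  east k c r = ~~ odd r.
Proof.
move=> kv /lee_outsideP[QT Qo] c1; case: r => [[|j] jp] /=.
  by have [-> _] := smod_top c kv; rewrite -(k_dT kv).
have jp' : (j < p)%N by apply: ltnW.
have jb : Ordinal jp' != bot by rewrite -row_botE /=; lia.
have [_ /= ->] := smod_levels kv c1 jb; rewrite -(Qo c _ c1 jb).
by have [_ _ -> _] := labelling_level c (Ordinal jp') kv.
Qed.

Lemma lee_outside_const a b o k c r : labelling (smod a b o) k ->
  lee_outside k -> c != 1 ->
  r != bot -> k ((c, r), 0) != k ((c, r), 2%:R).
Proof.
move=> kv Qk c1 rb; have [-> _ _ _] := labelling_level c r kv.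
by rewrite (lee_outside_east _ kv Qk c1); case/lee_outsideP: Qk => _ ->;
  rewrite //=; case: (odd r).
Qed.

(** An outer bottom crossing that is not cut joins the bottom circle to level [p.-1], which is even
    and hence coloured true. *)
Lemma lee_outside_merged a b o k : labelling (smod a b o) k -> lee_outside k ->
  a || b -> k dB.
Proof.
move=> kv Qk ab; have [_ Hb Hr] := labelling_levels kv.
have W1 : k dB = east k 0 p.
  have := Hb 0; rewrite add0r => ->.
  by have [_ _ -> _] := labelling_level 1 bot kv; rewrite /= prednK.
have pp : odd p.-1 = false by move: p_odd; case: (p) p_gt0 => //= n _ /negPf.
have E c : c != 1 -> east k c p.-1 by move=> c1;
  rewrite (lee_outside_east bot kv Qk c1) /= pp.
have := Hr 0 bot; have := Hr 2%:R bot.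
rewrite !cut_smod /= !eqxx !andbT prednK // => H2 H0.
rewrite W1; case: ifP H0 => [na [_ ->]|_ [<- _]]; last by rewrite E.
have := Hb 2%:R; rewrite (_ : 2%:R + 1 = 0 :> 'Z_3) => [<-|]; last exact/val_inj.
have b1 : b by move: ab; rewrite (negPf na).
by move: H2; rewrite b1 => -[<- _]; rewrite E.
Qed.

Lemma addc_smod1 a b r : addc (smod a b (Some r)) (1, r) = smod a b None.
Proof.
apply/ffunP=> -[c s]; rewrite !ffunE /= xpair_eqE; case: (c == 1) => //=.
by rewrite (eq_sym s) -(inj_eq (@Some_inj _)); case: eqP.
Qed.

Lemma addc_smod0 b o : addc (smod false b o) (0, bot) = smod true b o.
Proof.
apply/ffunP=> -[c s]; rewrite !ffunE /= xpair_eqE.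
by elim/Z3_case: c; rewrite //= orbF.
Qed.

Lemma addc_smod2 a o : addc (smod a false o) (2%:R, bot) = smod a true o.
Proof.
apply/ffunP=> -[c s]; rewrite !ffunE /= xpair_eqE.
by elim/Z3_case: c; rewrite //= orbF.
Qed.

Lemma row_other r : exists s : 'I_p, r != s.
Proof.
have [->|] := eqVneq r top; last by exists top.
by exists bot; apply: top_neq_bot.
Qed.

Lemma edge_coef_smod1 a b r : edge_coef (smod a b (Some r)) (1, r) = h.
Proof.
have [s rs] := row_other r; apply: edge_coef_uncut rs _ _.
- by rewrite ffunE /= eqxx.
- by rewrite addc_smod1 cut_smod.
- by rewrite addc_smod1 cut_smod.
Qed.

Lemma edge_coef_smod0 b o : edge_coef (smod false b o) (0, bot) = 1.
Proof.
have := top_neq_bot; rewrite eq_sym => H.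
by apply: edge_coef_cut H _ _; rewrite cut_smod.
Qed.

Lemma edge_coef_smod2 a o : edge_coef (smod a false o) (2%:R, bot) = 1.
Proof.
have := top_neq_bot; rewrite eq_sym => H.
by apply: edge_coef_cut H _ _; rewrite cut_smod.
Qed.

Definition supported a b o (f : {ffun dart K -> bool} -> R) (z : CKh K) : Prop :=
  forall w k, labelling w k -> coord w k z = (w == smod a b o)%:R * f k.

(** Only three edges survive: the merges at the two outer bottom crossings, with coefficient 1, and
    the split at the uncut central crossing, with coefficient [h]. After a merge the colours at the
    crossing agree automatically, so only the split keeps an equality factor. *)
Lemma coord_d_smod a b o f z : supported a b o f z ->
  (forall k, ~~ lee_outside k -> f k = 0) ->
  forall w k, labelling w k -> coord w k (dKh z) =
    ((w == smod true b o)%:R * (~~ a)%:R + (w == smod a true o)%:R * (~~ b)%:R +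
     (if o is Some r then
        (w == smod a b None)%:R * (k ((1, r), 0) == k ((1, r), 2%:R))%:R * h
      else 0)) * f k.
Proof.
move=> Hz fQ0 w k kw; rewrite (coord_d_at pretzel_edge_odd Hz kw).
have [Qk|/fQ0->] := boolP (lee_outside k); last by rewrite mulr0 big1 // => c _;
  rewrite !mulr0.
rewrite big_mkcond (bigD1 (0, bot)) //= (bigD1 (2%:R, bot)) //= !mulrDl -!addrA.
have kc0 : ~~ a -> w = smod true b o -> k ((0, bot), 0) = k ((0, bot), 2%:R).
  move=> na E; have H := @edge_coef_smod0 b o.
  apply: (merge_const pretzel_edge_odd _ _ H); first by rewrite ffunE.
  by rewrite addc_smod0 -E.
have kc2 : ~~ b -> w = smod a true o -> k ((2%:R, bot), 0) = k ((2%:R, bot), 2%:R).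
  move=> nb E; have H := @edge_coef_smod2 a o.
  apply: (merge_const pretzel_edge_odd _ _ H); first by rewrite ffunE.
  by rewrite addc_smod2 -E.
congr (_ + _).
  rewrite ffunE /= eqxx andbT; case: a Hz kc0 {kc2} => Hz kc0 /=.
    by rewrite mulr0 mul0r.
  rewrite addc_smod0; case: eqP => [E|]; last by rewrite !mul0r.
  by rewrite edge_coef_smod0 kc0 // eqxx !mul1r.
congr (_ + _).
  rewrite ffunE /= eqxx andbT; case: b Hz kc2 {kc0} => Hz kc2 /=.
    by rewrite mulr0 mul0r.
  rewrite addc_smod2; case: eqP => [E|]; last by rewrite !mul0r.
  by rewrite edge_coef_smod2 kc2 // eqxx !mul1r.
(* Any other outer crossing would join neighbouring circles to which [lee_outside] gives opposite
   colours. *)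
have out (c : pcrossing p) : (c != (0, bot)) && (c != (2%:R, bot)) -> c.1 != 1 ->
    ~~ smod a b o c -> w = addc (smod a b o) c -> k (c, 0) == k (c, 2%:R) -> False.
  case: c => c r /= /andP[c0 c2] c1 vc E kc.
  have rb : r != bot.
    by move: c0 c2 c1; elim/Z3_case: (c); rewrite !xpair_eqE //=.
  have kV : labelling (smod a b o) k.
    apply: (@labelling_transfer K w _ k (c, r)) (eqP kc) kw => b' nb.
    by rewrite E [RHS]ffunE (negPf nb).
  by move: (lee_outside_const kV Qk c1 rb); rewrite kc.
case: o Hz kc0 kc2 out => [r|] Hz _ _ out; last first.
  rewrite mul0r; apply: big1 => c cc; case: ifP => // /andP[vc /eqP E].
  have [c1|c1] := eqVneq c.1 1; first by move: vc; rewrite ffunE c1.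
  case: eqP => [H|]; last by rewrite mul0r.
  by case: (out c cc c1 vc E); rewrite H.
rewrite (bigD1 (1, r)) //= big1 => [|c /andP[cc cr]].
  rewrite addr0 ffunE /= eqxx addc_smod1 edge_coef_smod1.
  by case: (w == smod a b None); rewrite /= ?mul1r ?mul0r ?mulrA.
case: ifP => // /andP[vc /eqP E].
have [c1|c1] := eqVneq c.1 1.
  move: vc; rewrite ffunE c1 /= negbK => /eqP[E2].
  by move: cr; rewrite {1}[c]surjective_pairing c1 -E2 eqxx.
case: eqP => [H|]; last by rewrite mul0r.
by case: (out c cc c1 vc E); rewrite H.
Qed.

Lemma seifertE : seifert K = smod false false None.
Proof.
apply/ffunP=> c; rewrite [LHS]ffunE [RHS]ffunE pretzel_positive negbK.
by case: (_ == _) => //; case: (_ == 0).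
Qed.

Lemma leeX_lam (d : dart K) : leeX d = lam d.
Proof.
(* The north and south corners of each crossing are black, the west and east ones white. *)
pose col : {ffun dart K -> bool} := [ffun d : pdart p => ~~ odd (val d.2)].
have H : checkerboard (seifert K) col.
  apply/and4P; split; last by rewrite ffunE.
  - apply/forallP=> e; rewrite !ffunE rotV_odd.
    by rewrite (pretzel_edge_odd e) negbK.
  - apply/forallP=> e; apply/implyP=> _; rewrite !ffunE.
    by rewrite !rot_odd negbK.
  - by apply/forallP=> e; rewrite !ffunE rotV_odd.
rewrite /leeX (blackE H) ffunE /left_corner /lam; case: d => -[c r] i.
rewrite /dg_out /= /pout /=.
by elim/Z4P: i; case: (odd r) (oddD r 1) => /=; rewrite ?addn0 ?addn1 //= => ->.
Qed.

Lemma labelling_const_seifert k : labelling (seifert K) k ->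
  [forall d, k d == leeX d] =
  [&& lee_outside k, ~~ k dB & [forall r :
    'I_p, (r != bot) ==> (k ((1, r), 2%:R) == ~~ odd r.+1)]].
Proof.
rewrite seifertE => kv; have [Ht Hb Hr] := labelling_levels kv.
apply/forallP/and3P => [H|[Qk kB /forallP H]].
  split.
  - by apply/allP=> d _; rewrite (eqP (H d)) leeX_lam.
  - rewrite (eqP (H dB)) leeX_lam /lam /= addn1 prednK //.
    by rewrite negbK.
  - by apply/forallP=> r; apply/implyP=> _;
    rewrite (eqP (H _)) leeX_lam /lam /= addn1.
have cuts c r : east k c r = west k c r /\ east k c r.+1 = west k c r.+1.
  have := Hr c r; rewrite cut_smod; case: eqP => // _.
  by case: (_ == 0).
have [QT Qo] := (lee_outsideP k).1 Qk.
have W c j : (j < p.-1)%N -> west k c j.+1 = ~~ odd j.+1.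
  move=> jp; have jp' : (j < p)%N by lia.
  have jb : Ordinal jp' != bot by rewrite -row_botE /=; lia.
  have [_ _ E _] := labelling_level c (Ordinal jp') kv; rewrite -[LHS]E.
  have [->|c1] := eqVneq c 1; last exact: Qo.
  by apply/eqP; apply: (implyP (H (Ordinal jp'))).
have Wp c : west k c p = false.
  have Wb : west k 1 p = false.
    have [_ _ E _] := labelling_level 1 bot kv; rewrite /= prednK // in E.
    by rewrite -E; apply: negbTE.
  have Ew c' : west k (c' + 1) p = west k c' p.
    rewrite -Hb; have [_] := cuts c' bot; by rewrite /= prednK.
  have W2 : west k 2%:R p = false.
    by rewrite (_ : 2%:R = 1 + 1 :> 'Z_3) ?Ew //; apply/val_inj.
  elim/Z3_case: c => //; rewrite (_ : 0 = 2%:R + 1 :> 'Z_3) ?Ew //; exact/val_inj.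
have WA c j : (j <= p)%N -> west k c j = ~~ odd j.
  case: j => [_|j jp]; first by have [_ ->] := smod_top c kv; rewrite -(k_dT kv).
  have [E|jp'] := eqVneq j p.-1; last by apply: W; lia.
  by rewrite E prednK // Wp p_odd.
case=> -[c r] i; rewrite leeX_lam /lam;
  have [E0 E1 E2 E3] := labelling_level c r kv.
have [A B] := cuts c r; have rp := ltn_ord r.
by elim/Z4P: i; rewrite ?E0 ?E1 ?E2 ?E3 ?A ?B WA //= ?addn0 ?addn1 // ltnW.
Qed.

Lemma supported_tau a b o f z : supported a b o f z ->
  supported b a o (fun k => f (tau_label k)) (tauKh z).
Proof.
move=> Hz w k kw; rewrite coord_tau // Hz; last exact: tau_labelling.
congr (_%:R * _); rewrite (inv_eq (@tau_vertexK K)).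
by congr (_ == _); apply: tau_smod.
Qed.

Lemma lee_outside_tau a b o k : labelling (smod a b o) k -> lee_outside k ->
  lee_outside (tau_label k).
Proof.
move=> kv /lee_outsideP[QT Qo]; apply/lee_outsideP; split.
  rewrite ffunE (_ : si_tau dT = ((1, top), 1)); last first.
    by congr (_, _, _); apply/val_inj.
  have [_ -> _ _] := labelling_level 1 top kv; have [_] := smod_top 1 kv.
  by rewrite /= -(k_dT kv) QT.
move=> c r c1 rb; rewrite ffunE -[si_tau _]/(((2%:R - c, r), 1 - 2%:R) : pdart p).
have c1' : 2%:R - c != 1 by move: c1; elim/Z3_case: (c).
rewrite (_ : 1 - 2%:R = 3%:R) //; last exact/val_inj.
have [_ _ E2 E3] := labelling_level (2%:R - c) r kv;
  have [_ E] := smod_levels kv c1' rb.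
by rewrite E3 E -E2 Qo.
Qed.

(** The splits of the central column all land in [smod a b None], with total weight the number
    modulo 2 of rows whose two sides agree. It telescopes to [p] plus the top colour plus the bottom
    colour; [p] is odd and the top colour is true, which leaves [k dB]. *)
Lemma coord_d_sum_smod a b f (z_ : 'I_p -> CKh K) :
  (forall r, supported a b (Some r) f (z_ r)) -> (forall k, ~~ lee_outside k ->
    f k = 0) ->
  forall w k, labelling w k -> coord w k (dKh (\sum_r z_ r)) =
    (~~ a)%:R * (\sum_r (w == smod true b (Some r))%:R * f k) +
    (~~ b)%:R * (\sum_r (w == smod a true (Some r))%:R * f k) +
    (w == smod a b None)%:R * h * ((k dB)%:R * f k).
Proof.
move=> Hz fQ0 w k kw; rewrite dKh_sum coord_sum.
under eq_bigr => r _ do rewrite (coord_d_smod (Hz r) fQ0 kw) !mulrDl.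
rewrite !big_split /=; congr (_ + _ + _).
- by rewrite mulr_sumr; apply: eq_bigr => r _; rewrite mulrA [_ * (~~ a)%:R]mulrC.
- by rewrite mulr_sumr; apply: eq_bigr => r _; rewrite mulrA [_ * (~~ b)%:R]mulrC.
rewrite -mulr_suml -mulr_suml -mulr_sumr -!mulrA.
case: eqP => [E|]; last by rewrite !mul0r.
rewrite !mul1r mulrCA; congr (_ * _).
have [Qk|/fQ0->] := boolP (lee_outside k); last by rewrite !mulr0.
rewrite E in kw; congr (_ * _).
transitivity (\sum_(r < p) (west k 1 r == west k 1 r.+1)%:R : R).
  apply: eq_bigr => r _; have [-> _ -> _] := labelling_level 1 r kw.
  by have [_ _ /(_ 1 r)] := labelling_levels kw; rewrite cut_smod /= => -[->].
rewrite sum_eq_succ natr_odd //.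
have [_ E2] := smod_top 1 kw; rewrite E2 -(k_dT kw) (lee_outside_top Qk) addRR
  add0r.
by have [_ _ -> _] := labelling_level 1 bot kw; rewrite /= prednK.
Qed.

(** * Writhe and number of Seifert circles *)

Lemma writheE : writhe K = p%:Z.
Proof.
rewrite /writhe (eq_bigr (fun c : pcrossing p => if c.1 != 1 then 1 else -1)).
  2: by move=> c _; rewrite pretzel_positive.
rewrite -(pair_bigA _ (fun (c : 'Z_3) (r : 'I_p) => if c != 1 then 1 else -1 :
  int)) /=.
rewrite !big_ord_recl big_ord0 /= !big_const_ord !iter_addr_0 addr0.
by rewrite mulNrn addNr addr0 natz.
Qed.

Lemma seifert_levels k c : labelling (smod false false None) k ->
  (forall j, (j <= p)%N -> east k c j = west k c j) /\
  (west k c 0 = west k 0 0 /\ west k c p = west k 0 p).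
Proof.
move=> kv; have [Ht Hb Hr] := labelling_levels kv.
have cuts c' r : east k c' r = west k c' r /\ east k c' r.+1 = west k c' r.+1.
  have := Hr c' r; rewrite cut_smod; case: eqP => // _.
  by case: (_ == 0).
have Wp c' : west k (c' + 1) p = west k c' p.
  by rewrite -Hb; have [_] := cuts c' bot; rewrite /= prednK.
have W0 c' : west k (c' + 1) 0 = west k c' 0.
  by rewrite -Ht; have [] := cuts c' top.
split; last by elim/Z3P: c => // c [H1 H2]; rewrite Wp W0.
case=> [_|j jp]; first by have [] := cuts c top.
by have [_] := cuts c (Ordinal jp).
Qed.

Lemma seifert_label k (d : dart K) : labelling (smod false false None) k ->
  k d = west k d.1.1 (d.1.2 + (1 < val d.2)).
Proof.
move=> kv; case: d => -[c r] i; have [A _] := seifert_levels c kv.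
have [E0 E1 E2 E3] := labelling_level c r kv; have rp := ltn_ord r.
by elim/Z4P: i; rewrite /= ?E0 ?E1 ?E2 ?E3 ?A ?addn0 ?addn1 // ltnW.
Qed.

Lemma ncirclesE : ncircles (seifert K) = (3 * p).-1.
Proof.
have p1 : (0 < p.-1)%N by lia.
(* [None] is the top circle, [Some None] the bottom one, and the others are the [p.-1] inner circles
   of each column. *)
pose F := option (option ('Z_3 * 'I_p.-1)).
pose clf c j : F := if j == 0%N then None else if j == p then Some None else
  Some (Some (c, insubd (Ordinal p1) j.-1)).
pose cl (d : dart K) : F := clf d.1.1 (d.1.2 + (1 < val d.2))%N.
pose rep (f : F) : dart K := match f with
  | None => ((0, top), 0) | Some None => ((0, bot), 2%:R)
  | Some (Some (c, i)) => ((c, row i), 2%:R) end.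
have cF f : labelling (seifert K) (level_lab (fun c j =>
  clf c j == f) (fun c j => clf c j == f)).
  rewrite seifertE; apply: level_labP; split=> c.
  - by [].
  - by rewrite /clf eqxx (gtn_eqF p_gt0).
  - move=> r; rewrite cut_smod /=; case: eqP => // _.
    by case: (_ == 0).
have clE f d : level_lab (fun c j => clf c j == f) (fun c j =>
  clf c j == f) d = (cl d == f).
  case: d => -[c r] i; rewrite ffunE /cl /=.
  by elim/Z4P: i; rewrite /= ?addn0 ?addn1.
rewrite /ncircles (@n_comp_classify _ F (circ_rel (seifert K)) cl rep).
- rewrite !card_option card_prod !card_ord /Zp_trunc /=; lia.
- exact: circ_sym.
- move=> x y xy; apply/esym/eqP;
  have sxy : same_circle (seifert K) x y by exact: connect1.
  by rewrite -clE -(labelling_circle (cF _) sxy) clE.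
- case=> [[[c i]|]|]; rewrite /cl /rep /clf /=.
  + have ip := ltn_ord i; rewrite val_row; last by lia.
    rewrite addn1 /= ltn_eqF; last by lia.
    by congr (Some (Some (_, _))); apply/val_inj; rewrite val_insubd ip.
  + by rewrite addn1 prednK // eqxx (gtn_eqF p_gt0).
  + by [].
move=> d; apply: same_circle_labels => k; rewrite seifertE => kv.
rewrite !(seifert_label _ kv) /cl; set c := d.1.1; set j := (d.1.2 + _)%N.
have jp : (j <= p)%N by have := ltn_ord d.1.2; rewrite /j; case: (1 < _)%N; lia.
have [_ [H0 Hp]] := seifert_levels c kv; rewrite /clf.
case: eqP => [->|/eqP j0]; first by rewrite /= addn0 H0.
case: eqP => [->|/eqP jp']; first by rewrite /= addn1 prednK // Hp.
have E : insubd (Ordinal p1) j.-1 = j.-1 :> nat.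
  by rewrite val_insubd (_ : (_ < _)%N); last by lia.
by rewrite /= addn1 val_row E ?prednK //; lia.
Qed.

Lemma rasmussenE n : rasmussen_of K n = (2 * n)%:Z - (2 * p.-1)%:Z.
Proof. rewrite /rasmussen_of writheE ncirclesE; lia. Qed.

(** * The cycle w, and the Lee cycle as a multiple of it *)

Lemma realize_supported a b o (ds : seq (dart K)) n : (size ds <= n)%N ->
  exists z, supported a b o (fun k => h ^+ n * (all (fun d =>
    k d == lam d) ds)%:R) z.
Proof. exact: realize. Qed.

Lemma lam_dB : lam dB = false.
Proof. by rewrite /lam /= addn1 prednK // p_odd. Qed.

Lemma supported_inj a b o f f' z z' : supported a b o f z ->
  supported a b o f' z' ->
  (forall k, labelling (smod a b o) k -> f k = f' k) -> z = z'.
Proof.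
move=> Hz Hz' ff; apply: coord_inj => w k kw; rewrite Hz // Hz' //.
by case: eqP => [E|]; rewrite ?mul0r // ff // -E.
Qed.

Lemma lee_outside_tauE a b o k : labelling (smod a b o) k ->
  lee_outside (tau_label k) = lee_outside k.
Proof.
move=> kv; apply/idP/idP; last exact: (lee_outside_tau kv).
have kv' : labelling (smod b a o) (tau_label k).
  by rewrite -tau_smod; apply: tau_labelling kv.
by move/(lee_outside_tau kv'); rewrite tau_labelK.
Qed.

Lemma dB_tau o k : labelling (smod false false o) k -> tau_label k dB = k dB.
Proof.
move=> kv; rewrite ffunE (_ : si_tau dB = ((1, bot), 3%:R)); last first.
  by congr (_, _, _); apply/val_inj.
have [_ Hb Hr] := labelling_levels kv; have [_ _ E2 E3] := labelling_level 1 bot kv.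
rewrite E2 E3 /= prednK //.
have := Hr 0 bot; have := Hr 2%:R bot;
  rewrite !cut_smod /= prednK // => -[_ B] [_ A].
have := Hb 0; have := Hb 1; have := Hb 2%:R.
rewrite (_ : 2%:R + 1 = 0 :> 'Z_3); last exact/val_inj.
by rewrite add0r (_ : 1 + 1 = 2%:R :> 'Z_3) // => F2 -> <-; rewrite -B F2 A.
Qed.

(** For [n = 2 * p], the number of circles with a prescribed label, these are the coordinates of the
    cycle w. *)
Definition bot_coef n k : R := h ^+ n * (lee_outside k && ~~ k dB)%:R.

Lemma bot_coef_all n k : h ^+ n * (all (fun d => k d == lam d) [::
  dB, dT & outs])%:R = bot_coef n k.
Proof. by rewrite /bot_coef /= lam_dB eqbF_neg andbC. Qed.

Lemma seifert_cycle n : (2 * p <= n)%N ->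
  exists w, supported false false None (bot_coef n) w.
Proof.
move=> np; have [|w Hw] := @realize_supported false false None [:: dB, dT & outs] n.
  by rewrite /= size_outs //; lia.
by exists w => v k kv; rewrite Hw // bot_coef_all.
Qed.

Lemma bot_coef0 n k : ~~ lee_outside k -> bot_coef n k = 0.
Proof. by rewrite /bot_coef => /negPf->; rewrite mulr0. Qed.

Lemma bot_coef_merged n a b o k : labelling (smod a b o) k -> a || b ->
  bot_coef n k = 0.
Proof.
rewrite /bot_coef => kv ab; case Qk: (lee_outside k); last by rewrite mulr0.
by rewrite (lee_outside_merged kv Qk ab) mulr0.
Qed.

(** Both outgoing merges force the bottom circle to be true, against the factor [~~ k dB]. *)
Lemma seifert_cycle_d n w : supported false false None (bot_coef n) w -> dKh w = 0.
Proof.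
move=> Hw; apply: coord_inj0 => v k kv.
rewrite (coord_d_smod Hw (@bot_coef0 n) kv) addr0 !mulr1.
have [E|_] := eqVneq v (smod true false None).
  by rewrite E in kv; rewrite (bot_coef_merged _ kv) ?mulr0.
have [E|_] := eqVneq v (smod false true None).
  by rewrite E in kv; rewrite (bot_coef_merged _ kv) ?mulr0.
by rewrite addr0 mul0r.
Qed.

Lemma seifert_cycle_tau n w : supported false false None (bot_coef n) w ->
  tauKh w = w.
Proof.
move=> Hw; apply: (supported_inj (supported_tau Hw) Hw) => k kv.
by rewrite /bot_coef (lee_outside_tauE kv) (dB_tau kv).
Qed.

Definition prefix_lam k j : bool :=
  all (fun i => k ((1, row i), 2%:R) == ~~ odd i.+1) (iota 0 j).

Lemma prefix_lamS k j :
  prefix_lam k j.+1 = prefix_lam k j && (k ((1, row j), 2%:R) == ~~ odd j.+1).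
Proof. by rewrite /prefix_lam -[X in iota 0 X]addn1 iotaD all_cat /= andbT. Qed.

(** If the Lee colours hold above row [r], then equal colours on both sides of the row mean exactly
    that the next Lee colour fails. *)
Lemma prefix_step k r : labelling (smod false false None) k -> lee_outside k ->
  (k ((1, r), 0) == k ((1, r), 2%:R)) && prefix_lam k r =
  (prefix_lam k r.+1 != prefix_lam k r).
Proof.
move=> kv Qk; rewrite prefix_lamS rowE.
case A: (prefix_lam k r) => /=; last by rewrite andbF.
have [W [W0 _]] := seifert_levels 1 kv.
have [E0 _ E2 _] := labelling_level 1 r kv.
have -> : k ((1, r), 0) = ~~ odd r.
  rewrite E0 W; last exact: ltnW.
  case: r A {E0 E2} => [[|j] jp] A /=.
    have [_ W1] := smod_top 1 kv.
    by rewrite W1 -(k_dT kv) (lee_outside_top Qk).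
  move: A; rewrite [X in prefix_lam _ X]/= prefix_lamS => /andP[_ /eqP].
  have [_ _ -> _] := labelling_level 1 (row j) kv.
  by rewrite val_row //; apply: ltnW.
by rewrite /= andbT; case: (odd r); case: (k _).
Qed.

(** At most [2 * p + (p - 2)] labels are prescribed when [r] is not the bottom row; the factor [h]
    of the split then gives the exponent [(3 * p).-1] of the Lee cycle. *)
Definition prefix_coef r k : R := h ^+ (3 * p - 2) * ((lee_outside k &&
  ~~ k dB) && prefix_lam k r)%:R.

Lemma realize_prefix_coef r : r != bot ->
  exists z, supported false false (Some r) (prefix_coef r) z.
Proof.
rewrite -row_botE /= => rb; have rp := ltn_ord r.
have [|z Hz] := @realize_supported false false (Some r)
  ([:: dB, dT & outs] ++ [seq ((1, row i), 2%:R) | i <- iota 0 r]) (3 * p - 2).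
  rewrite size_cat size_map size_iota /= size_outs //; lia.
exists z => v k kv; rewrite Hz // all_cat all_map.
have -> : all (fun d => k d == lam d) [:: dB, dT & outs] = lee_outside k && ~~ k dB.
  by rewrite /= lam_dB // eqbF_neg andbC.
congr (_%:R * (_ * (_ && _)%:R)); apply: eq_in_all => i.
rewrite mem_iota /= add0n => ir.
by rewrite /lam /= val_row ?addn1 //; apply: ltn_trans ir rp.
Qed.

(** The split at row [r] contributes the difference of the indicators of [prefix_lam k r] and
    [prefix_lam k r.+1]. These telescope from w, with no condition on the central inner circles, to
    the Lee cycle, with all of them. *)
Lemma lee_under_exact : exists w b, [/\ supported false false None (bot_coef (2 *
  p)) w,
  lee K = h ^+ p.-1 *: w + dKh b & tauKh b = b].
Proof.
have [w Hw] := @seifert_cycle (2 * p) (leqnn _).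
have /fin_all_exists[z Hz] r : exists z, supported false false (Some r)
    (fun k => (r != bot)%:R * prefix_coef r k) z.
  have [_|/realize_prefix_coef[z Hz]] := eqVneq r bot; last first.
    by exists z => v k kv; rewrite mul1r Hz.
  by exists 0 => v k kv; rewrite coord0 mul0r mulr0.
exists w, (\sum_r z r); split=> //.
  apply: coord_inj => v k kv; rewrite coordD coordZ Hw // coord_lee // ncirclesE //.
  rewrite dKh_sum coord_sum seifertE.
  have fQ0 r k' : ~~ lee_outside k' -> (r != bot)%:R * prefix_coef r k' = 0.
    by rewrite /prefix_coef => /negPf->; rewrite !mulr0.
  have fm a b r : labelling (smod a b (Some r)) k -> a || b ->
    (r != bot)%:R * prefix_coef r k = 0.
    move=> kV ab; rewrite /prefix_coef; case Qk: (lee_outside k);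
      last by rewrite !mulr0.
    by rewrite (lee_outside_merged kV Qk ab) !mulr0.
  rewrite (eq_bigr (fun r => (v == smod false false None)%:R * (h *
      ((k ((1, r), 0) == k ((1, r), 2%:R))%:R * ((r != bot)%:R *
        prefix_coef r k))))); last first.
    move=> r _; rewrite (coord_d_smod (Hz r) (fQ0 r) kv) !mulr1.
    rewrite mulrDl (_ : _ * _ = 0) ?add0r; last first.
      have [E|_] := eqVneq v (smod true false (Some r)).
        by rewrite (fm true false) ?mulr0 // -E.
      have [E|_] := eqVneq v (smod false true (Some r)).
        by rewrite (fm false true) ?mulr0 // -E.
      by rewrite addr0 mul0r.
    by rewrite -!mulrA; congr (_ * _); rewrite mulrCA.
  rewrite -mulr_sumr; case: eqP => [E|]; last by rewrite !mul0r mulr0 add0r.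
  rewrite !mul1r labelling_const_seifert //; last by rewrite seifertE -E.
  rewrite E in kv; rewrite /bot_coef /prefix_coef; case Qk: (lee_outside k);
    last first.
    by rewrite !mulr0 add0r big1 // => r _; rewrite !mulr0.
  case kB: (k dB) => /=.
    by rewrite !mulr0 add0r big1 // => r _; rewrite !mulr0.
  have -> : [forall r : 'I_p, (r != bot) ==> (k ((1, r), 2%:R) == ~~ odd r.+1)]
      = prefix_lam k p.-1.
    apply/forallP/allP => [H i|H r].
      rewrite mem_iota add0n => /andP[_ ip].
      have := H (row i); rewrite val_row; last by lia.
      by move/implyP; apply; rewrite -row_botE /= val_row; lia.
    apply/implyP; rewrite -row_botE /= => rb; have rp := ltn_ord r.
    have := H r; rewrite rowE; apply; rewrite mem_iota /=; lia.
  (* The bottom row has the zero chain; [minn] makes its difference vanish too. *)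
  pose x j : R := (prefix_lam k (minn j p.-1))%:R.
  rewrite (eq_bigr (fun r => h ^+ (3 * p).-1 * (x r + x r.+1))); last first.
    move=> r _; rewrite [_%:R * (h ^+ _ * _)]mulrCA [_%:R * (h ^+ _ * _)]mulrCA.
    rewrite (_ : (3 * p).-1 = (3 * p - 2).+1) ?exprS -?mulrA; last by lia.
    congr (_ * _).
    congr (_ * _); rewrite mulrCA -natrM mulnb prefix_step //.
    rewrite -row_botE /= /x; have rp := ltn_ord r.
    have [E2|nE] := eqVneq r.+1 p.
      by rewrite mul0r !(minn_idPr _) ?addRR //; lia.
    rewrite mul1r !(minn_idPl _); [|lia|lia].
    by case: (prefix_lam k r); case: (prefix_lam k r.+1);
      rewrite ?addr0 ?add0r ?addRR.
  rewrite -mulr_sumr telescope_pchar2 /x min0n (minn_idPr (leq_pred p)) /=.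
  rewrite mulr1 -exprD (_ : (p.-1 + 2 * p)%N = (3 * p).-1); last by lia.
  by rewrite mulrDr mulr1 addrA addRR add0r.
rewrite tauKh_sum; apply: eq_bigr => r _.
apply: (supported_inj (supported_tau (Hz r)) (Hz r)) => k kv; congr (_ * _).
rewrite /prefix_coef (lee_outside_tauE kv) (dB_tau kv); congr (_ * (_ && _)%:R).
apply: eq_in_all => i; rewrite mem_iota add0n => /andP[_ ir]; congr (_ == _).
rewrite ffunE.
rewrite (_ : @si_tau K _ = ((1, row i), 3%:R)); last first.
  by congr (_, _, _); apply/val_inj.
have [_ _ E2 E3] := labelling_level 1 (row i) kv; rewrite E2 E3.
have [_ _ /(_ 1 (row i))] := labelling_levels kv; rewrite cut_smod /=.
have ip : (i < p)%N by apply: ltn_trans ir (ltn_ord r).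
case: eqP => [[Er]|_ [_ ->] //].
by move: ir; rewrite Er val_row // ltnn.
Qed.

(** * The upper Lee class as a multiple of h^p *)

Definition top_coef n k : R := h ^+ n * (lee_outside k)%:R.

Lemma top_coef0 n k : ~~ lee_outside k -> top_coef n k = 0.
Proof. by rewrite /top_coef => /negPf->; rewrite mulr0. Qed.

Lemma realize_top_coef a b o n : (2 * p - 1 <= n)%N ->
  exists z, supported a b o (top_coef n) z.
Proof.
move=> pn; have [|z Hz] := @realize_supported a b o (dT :: outs) n.
  by rewrite /= size_outs //; lia.
by exists z.
Qed.

Lemma top_coef_tau n a b o k : labelling (smod a b o) k ->
  top_coef n (tau_label k) = top_coef n k.
Proof. by move=> kv; rewrite /top_coef (lee_outside_tauE kv). Qed.

Lemma top_coef_S n k : h * top_coef n k = top_coef n.+1 k.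
Proof. by rewrite /top_coef exprS mulrA. Qed.

(* When both outer columns have their bottom crossing merged, two of the
   labels prescribed by lee_outside are on the same circle. *)
Lemma realize_top_coef_merged o :
  exists z, supported true true o (top_coef (2 * p - 2)) z.
Proof.
(* The dropped circle is the one at level [p.-1] of the right column, now joined to its counterpart
   in the left column. *)
pose ds := [seq d <- outs | d != ((2%:R, row p.-2), 2%:R)].
have rb : row p.-2 != bot by rewrite -row_botE /= val_row; lia.
have din : ((2%:R, row p.-2), 2%:R) \in outs.
  apply/allpairsP; exists (2%:R, row p.-2); split=> //=.
  by rewrite mem_filter rb mem_enum.
have [|z Hz] := @realize_supported true true o (dT :: ds) (2 * p - 2).
  rewrite /= size_filter; have := count_predC (pred1 ((2%:R, row p.-2), 2%:R)) outs.
  have : (0 < count (pred1 ((2%:R, row p.-2), 2%:R)) outs)%N.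
    by rewrite -has_count has_pred1.
  rewrite size_outs // (@eq_count _ (predC _) (fun d =>
    d != ((2%:R, row p.-2), 2%:R))) //; lia.
exists z => v k kv; rewrite Hz //; case: eqP => [E|]; last by rewrite !mul0r.
rewrite E in kv; congr (_ * (_ * _%:R)).
rewrite /lee_outside /=; congr (_ && _).
apply/allP/allP => H d; last by rewrite mem_filter => /andP[_ /H].
have [->|nd] := eqVneq d ((2%:R, row p.-2), 2%:R); last first.
  by move=> dd; apply: H; rewrite mem_filter nd.
move=> _; have [_ Hb Hr] := labelling_levels kv.
have d0 : ((0, row p.-2), 2%:R) \in ds.
  rewrite mem_filter; apply/andP; split; first by rewrite !xpair_eqE.
  apply/allpairsP; exists (0, row p.-2); split=> //=.
  by rewrite mem_filter rb mem_enum.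
have := H _ d0; rewrite /lam /=.
have [_ _ -> _] := labelling_level 0 (row p.-2) kv.
have [_ _ -> _] := labelling_level 2%:R (row p.-2) kv.
have rE : (row p.-2).+1 = p.-1 :> nat by rewrite val_row; lia.
rewrite rE.
have [_ A] := smod_levels kv (c := 2%:R) isT rb.
rewrite rE in A.
have := Hr 2%:R bot; have := Hr 0 bot.
rewrite !cut_smod /= eqxx prednK // => -[_ B] [C _].
have := Hb 2%:R; rewrite (_ : 2%:R + 1 = 0 :> 'Z_3) => [D|]; last exact/val_inj.
by rewrite -A C D -B.
Qed.

(** The first two equations make [(g, u)] a cycle of the cone. The last two say that [lee_over K] is
    [h ^+ p *: (g, u)] plus the boundary of [(e, b)]. *)
Lemma lee_over_exact : exists g u e b : CKh K,
  [/\ dKh g = 0, g - tauKh g - dKh u = 0,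
      dKh e = h ^+ p *: g & lee K = h ^+ p *: u + (e - tauKh e) - dKh b].
Proof.
have [w [bB [Hw leeE bBt]]] := lee_under_exact.
pose m := (2 * p - 1)%N.
have [u Hu] := @realize_top_coef false false None m (leqnn _).
have [g1 Hg1] := @realize_top_coef true false None m (leqnn _).
have /fin_all_exists[b Hb] r := @realize_top_coef false false (Some r) m (leqnn _).
have /fin_all_exists[e He] r := @realize_top_coef true false (Some r) m (leqnn _).
have /fin_all_exists[g2 Hg2] r := realize_top_coef_merged (Some r).
pose E := \sum_r e r; pose G := \sum_r g2 r; pose B := \sum_r b r.
have mS : (2 * p - 2).+1 = m by rewrite /m; lia.
have dB1 a o k : labelling (smod a true o) k ->
  top_coef m k * (k dB)%:R = top_coef m k.
  move=> kv; rewrite /top_coef; case Qk: (lee_outside k);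
    last by rewrite mulr0 mul0r.
  by rewrite (lee_outside_merged kv Qk) ?orbT // mulr1.
have dB1' b' o k : labelling (smod true b' o) k ->
  top_coef m k * (k dB)%:R = top_coef m k.
  move=> kv; rewrite /top_coef; case Qk: (lee_outside k);
    last by rewrite mulr0 mul0r.
  by rewrite (lee_outside_merged kv Qk) // mulr1.
have Ht a a' o z : supported a a' o (top_coef m) z ->
  supported a' a o (top_coef m) (tauKh z).
  move=> Hz v k kv; rewrite (supported_tau Hz kv); case: eqP => [Ev|];
    last by rewrite !mul0r.
  by rewrite Ev in kv; rewrite (top_coef_tau _ kv).
(* The splits give the factor [h] directly. The merges into [smod true true (Some r)] give it
   because one label fewer is prescribed there, so that [g2 r] exists with exponent [2 * p - 2]. *)
have dE : dKh E = h *: (g1 + G).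
  apply: coord_inj => v k kv; rewrite (coord_d_sum_smod He (@top_coef0 m) kv).
  rewrite coordZ coordD Hg1 // coord_sum !mul0r add0r mul1r addrC mulrDr.
  congr (_ + _).
    rewrite -mulrA; case: eqP => [Ev|]; last by rewrite !mul0r mulr0.
    by rewrite Ev in kv; rewrite !mul1r [_%:R * _]mulrC (dB1' _ _ _ kv).
  rewrite mulr_sumr; apply: eq_bigr => r _.
  by rewrite Hg2 // [RHS]mulrCA top_coef_S mS.
have dU : dKh u = g1 + tauKh g1.
  apply: coord_inj => v k kv; rewrite (coord_d_smod Hu (@top_coef0 m) kv).
  by rewrite coordD Hg1 // (Ht _ _ _ _ Hg1) // addr0 !mulr1 mulrDl.
have tG : tauKh G = G.
  rewrite tauKh_sum; apply: eq_bigr => r _.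
  by apply: (supported_inj (supported_tau (Hg2 r)) (Hg2 r)) => k kv;
    apply: top_coef_tau kv.
have dG : dKh (g1 + G) = 0.
  apply: coord_inj0 => v k kv; rewrite dKhD coordD.
  rewrite (coord_d_smod Hg1 (@top_coef0 m) kv).
  rewrite (coord_d_sum_smod Hg2 (@top_coef0 _) kv) !mul0r !add0r !mulr0 add0r
    addr0 mulr1.
  case: eqP => [Ev|]; last by rewrite !mul0r addr0.
  rewrite Ev in kv; rewrite !mul1r mulrCA top_coef_S mS mulrC (dB1 _ _ _ kv);
    exact: addRR.
(* The merges at the two outer bottom crossings give [E] and its mirror image. The splits give the
   part of [h *: u] with [k dB] true, that is, [h *: u + w]. *)
have dBE : dKh B = E + tauKh E + h *: u + w.
  apply: coord_inj => v k kv; rewrite (coord_d_sum_smod Hb (@top_coef0 m) kv).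
  rewrite !coordD !coordZ coord_sum tauKh_sum coord_sum Hu // Hw // !mul1r
    -[RHS]addrA.
  congr (_ + _ + _).
  - by apply: eq_bigr => r _; rewrite He.
  - by apply: eq_bigr => r _; rewrite (Ht _ _ _ _ (He r)).
  case: eqP => [Ev|]; last by rewrite !mul0r mulr0 addr0.
  rewrite !mul1r mulrCA top_coef_S /bot_coef /top_coef (_ : m.+1 = (2 * p)%N);
    last by lia.
  case: (lee_outside k) => /=; case: (k dB) => /=;
    rewrite ?mulr0 ?mul0r ?addr0 ?mul1r ?mulr1 ?addRR //.
have pE : p.-1.+1 = p by rewrite prednK.
exists (g1 + G), u, (h ^+ p.-1 *: E), (h ^+ p.-1 *: B + bB).
split=> //.
- rewrite dU tauKhD tG !CKh_oppr [X in X + _]addrACA [G + G]CKh_addrr addr0.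
  exact: CKh_addrr.
- by rewrite dKhZ dE scalerA -exprSr pE.
rewrite leeE dKhD dKhZ dBE tauKhZ !CKh_oppr !scalerDr scalerA -exprSr pE.
set X := _ *: E; set Y := _ *: tauKh E; set Z := _ *: u; set W := _ *: w.
rewrite [X + Y + Z]addrC -[_ + W + _]addrA [RHS]addrA.
by rewrite [_ + (X + Y) + _]CKh_addrr add0r.
Qed.

Lemma level_labE (e : 'Z_3 -> nat -> bool) (d : dart K) :
  level_lab e e d = e d.1.1 (d.1.2 + (1 < val d.2))%N.
Proof.
by case: d => -[c r] i; rewrite ffunE; elim/Z4P: i; rewrite /= ?addn0 ?addn1.
Qed.

Definition lam_ffun : {ffun dart K -> bool} := [ffun d => lam d].

Lemma lam_ffunP : labelling (seifert K) lam_ffun.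
Proof.
rewrite seifertE (_ : lam_ffun = level_lab (fun _ j => ~~ odd j) (fun _ j =>
  ~~ odd j)).
  apply: level_labP; split=> // c r; rewrite cut_smod; case: eqP => // _.
  by case: (_ == 0).
by apply/ffunP=> d; rewrite ffunE level_labE.
Qed.

Lemma sum_coord_lee (P : pred {ffun dart K -> bool}) : P lam_ffun ->
  \sum_(k | labelling (seifert K) k && P k) coord (seifert K) k (lee K) =
  h ^+ (3 * p).-1.
Proof.
move=> Plam; rewrite (bigD1 lam_ffun) ?lam_ffunP //= big1 =>
  [|k /andP[/andP[kv _] nk]].
  rewrite addr0 coord_lee ?lam_ffunP // eqxx mul1r ncirclesE //.
  rewrite (_ : [forall d, _]) ?mulr1 //.
  by apply/forallP=> d; rewrite ffunE leeX_lam.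
rewrite coord_lee // eqxx mul1r (_ : [forall d, _] = false) ?mulr0 //.
apply: contraNF nk => /forallP H; apply/eqP/ffunP=> d.
by rewrite (eqP (H d)) leeX_lam ffunE.
Qed.

(** * Upper bounds *)

Definition alternates k : bool :=
  [forall r : 'I_p, k ((1, r), 0) != k ((1, r), 2%:R)].

Definition phi_over (z : CKh K) : R :=
  \sum_(k | labelling (seifert K) k && alternates k) coord (seifert K) k z.

Lemma phi_overZ (a : R) z : phi_over (a *: z) = a * phi_over z.
Proof. by rewrite mulr_sumr; apply: eq_bigr => k _; rewrite coordZ. Qed.

Lemma phi_overB z z' : phi_over (z - z') = phi_over z - phi_over z'.
Proof.
rewrite opprR -big_split; apply: eq_bigr => k _; by rewrite coordD coordN.
Qed.

(** Edges into the Seifert resolution come only from central crossings, and reach only colourings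
    that agree across that crossing, which alternation excludes. *)
Lemma phi_over_d z : phi_over (dKh z) = 0.
Proof.
apply: big1 => k /andP[kv /forallP ka]; rewrite (coord_d pretzel_edge_odd) //.
apply: big1 => -[c r]; rewrite seifertE ffunE /=; case: eqP => [->|_].
  by move=> _; rewrite (negPf (ka r)) !mul0r.
by case: (_ == 0).
Qed.

Lemma phi_over_tau z : phi_over (tauKh z) = phi_over z.
Proof.
have tS : tau_vertex (seifert K) = seifert K.
  by rewrite seifertE; apply: tau_smod.
have tl k : labelling (seifert K) k -> labelling (seifert K) (tau_label k).
  by move=> kv; rewrite -tS; apply: tau_labelling.
have ta k : labelling (seifert K) k -> alternates k -> alternates (tau_label k).
  move=> kv /forallP ka; apply/forallP=> r; rewrite !ffunE.
  rewrite (_ : @si_tau K ((1, r), 0) = ((1, r), 1)); last first.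
    by congr (_, _, _); apply/val_inj.
  rewrite (_ : @si_tau K ((1, r), 2%:R) = ((1, r), 3%:R)); last first.
    by congr (_, _, _); apply/val_inj.
  have := ka r; rewrite seifertE in kv;
    have [-> -> -> ->] := labelling_level 1 r kv.
  by have [_ _ /(_ 1 r)] := labelling_levels kv; rewrite cut_smod /= => -[-> ->].
rewrite /phi_over (reindex_inj (inv_inj (@tau_labelK K))) /=.
apply: eq_big => k.
  apply/andP/andP => -[A B].
    by split; [have := tl _ A|have := ta _ A B]; rewrite (@tau_labelK K).
  by split; [apply: tl|apply: ta].
case/andP=> A _; apply: etrans (@coord_tau K _ _ z A) _.
by rewrite tS (@tau_labelK K).
Qed.

(** There are [2 * p - 1] flips preserving alternation: one for each inner circle of the outer
    columns, and one for the central column together with the top and bottom circles. *)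
Lemma phi_over_dvd z : exists a, phi_over z = h ^+ (2 * p - 1) * a.
Proof.
pose F := option (bool * 'I_p.-1).
pose e (f : F) c j := if f is Some (b, i) then
  (c == if b then 0 else 2%:R) && (j == i.+1) else (c == 1) || (j == 0%N) || (j
    == p).
have cF : (2 * p - 1)%N = #|{: F}|.
  by rewrite card_option card_prod card_bool card_ord; lia.
rewrite cF; apply: (dvd_sum_coord (K := fun f => level_lab (e f) (e f))).
- move=> f; rewrite seifertE; apply: level_labP; split=> c.
  + by case: f => [[b i]|]; rewrite /e /= ?andbF ?orbT.
  + case: f => [[b i]|]; rewrite /e /= ?eqxx ?orbT //.
    by rewrite gtn_eqF ?andbF //; have := ltn_ord i; lia.
  + by move=> r; rewrite cut_smod; case: eqP => // _; case: (_ == 0).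
- case=> [[b i]|]; last by exists dT; rewrite level_labE.
  exists ((if b then 0 else 2%:R, row i), 2%:R).
  by rewrite level_labE /e /= val_row ?addn1 ?eqxx //; have := ltn_ord i; lia.
- move=> f g d; rewrite !level_labE /e.
  case: f => [[b i]|]; case: g => [[b' i']|] //.
  + case/andP=> /eqP-> /eqP-> /andP[/eqP bb /eqP[ii]].
    congr (Some (_, _)); last exact/val_inj.
    by move: bb; case: b; case: b'.
  + case/andP=> /eqP-> /eqP->; have := ltn_ord i.
    by rewrite orbF; case: b => /=; lia.
  + move=> H /andP[/eqP E /eqP E2]; move: H; rewrite E E2; have := ltn_ord i'.
    by rewrite orbF; case: b' {E} => /=; lia.
move=> f k kv /forallP ka; apply/forallP=> r; rewrite !ffunE /=.
have := ka r; suff -> : e f 1 r = e f 1 r.+1 by case: (e f 1 _);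
  rewrite ?addbF // !addbT (inj_eq negb_inj).
by rewrite /e; case: f => [[b i]|] //; case: b.
Qed.

(** Invariance of [phi_over] under the involution kills the part of the cone differential coming
    from the first component. The bound is read off from (3p - 1) = p + (2p - 1). *)
Lemma over_bound n : divisible (@dKhI K) n (lee_over K) -> (n <= p)%N.
Proof.
apply: (@divisible_bound _ _ (fun z : CKhI K => phi_over z.2) _ _ _ (2 * p - 1)).
- by move=> a z; apply: phi_overZ.
- by move=> x y; apply: phi_overB.
- move=> z; rewrite [LHS]phi_overB [X in X - _]phi_overB phi_over_tau subrr.
  by rewrite phi_over_d subrr.
- by move=> z; apply: phi_over_dvd.
rewrite /= /phi_over sum_coord_lee; first by congr (_ ^+ _); lia.
apply/forallP=> r; rewrite !ffunE /lam /= addn0 addn1 /=.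
by case: (odd r).
Qed.

(* The right column is cut; the left and the central column are cut exactly at
   the rows outside J. *)
Definition paired J : vertex K :=
  [ffun c : pcrossing p => if c.1 == 1 then c.2 \notin J
                           else (c.1 == 0) && (c.2 \in J)].

Lemma cut_paired J c r : cut (paired J) c r = (c == 2%:R) || (r \notin J).
Proof. by rewrite /cut ffunE /=; elim/Z3_case: c; rewrite /= ?eqbF_neg. Qed.

(* Invariance under the reflection exchanging the left and central columns. *)
Definition mirror_sym k : bool := [forall r : 'I_p, [forall i : 'Z_4,
  k ((0, r), i) == k ((1, r), 1 - i)]].

Lemma mirror_symP k : reflect (forall r i, k ((0, r), i) =
  k ((1, r), 1 - i)) (mirror_sym k).
Proof.
apply: (iffP forallP) => [H r i|H r]; last by apply/forallP=> i; rewrite H.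
by have /forallP/(_ i)/eqP := H r.
Qed.

Lemma mirror_sym_level_lab (e w : 'Z_3 -> nat -> bool) :
  (forall j, e 0 j = w 1 j) -> (forall j, w 0 j = e 1 j) ->
    mirror_sym (level_lab e w).
Proof.
move=> H1 H2; apply/mirror_symP=> r i; rewrite !ffunE.
by elim/Z4P: i => /=; rewrite ?H1 ?H2.
Qed.

Lemma mirror_sym_add k k' : mirror_sym k -> mirror_sym k' ->
  mirror_sym [ffun d => k d (+) k' d].
Proof. by move=> /mirror_symP A /mirror_symP B; apply/mirror_symP=> r i;
  rewrite !ffunE A B. Qed.

Section Flip.
Variable J : {set 'I_p}.

(* The classes of levels in the left and central columns are delimited by the
   rows outside J: the class inl (Some s) starts just below the row s, the class
   inl None contains the top circle.  The class inr i is an inner circle of the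
   right column. *)
Definition level_class (f : option {s : 'I_p | s \notin J} + 'I_p.-1) c j : bool :=
  match f with
  | inl None => ~~ ((c == 2%:R) && (0 < j < p)%N) &&
      [forall s : 'I_p, (s \notin J) ==> (j <= s)%N]
  | inl (Some s) => [&& ~~ ((c == 2%:R) && (0 < j < p)%N), (val s < j)%N &
      [forall t : 'I_p, (t \notin J) && (t < j)%N ==> (t <= val s)%N]]
  | inr i => (c == 2%:R) && (j == i.+1)
  end.

Lemma level_classP f :
  labelling (paired J) (level_lab (level_class f) (level_class f)).
Proof.
apply: level_labP; split=> c.
- by case: f => [[s|]|i]; rewrite /= ?andbF.
- case: f => [[s|]|i]; rewrite /= ?ltnn ?andbF //.
  by rewrite gtn_eqF ?andbF //; have := ltn_ord i; lia.
move=> r; rewrite cut_paired; case: eqP => //= c2; case: ifP => // /negbT;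
  rewrite negbK.
move=> rJ; have nJ t : t \notin J -> (t : nat) != r.
  by apply: contraNneq => /val_inj->.
have tE t : t \notin J -> (t < r)%N = (t < r.+1)%N.
  by move/nJ; lia.
suff E : level_class f c r = level_class f c r.+1 by rewrite E.
rewrite /level_class; have /negPf-> : c != 2%:R by apply/eqP.
case: f => [[[s sJ]|]|i] //=.
  rewrite -tE //; congr (_ && _); apply: eq_forallb => t.
  by case tJ: (t \notin J); rewrite //= tE.
apply: eq_forallb => t; case tJ: (t \notin J) => //=.
by have := nJ _ tJ; lia.
Qed.

Lemma level_class_disjoint f g c j : level_class f c j -> level_class g c j ->
  f = g.
Proof.
case: f => [[[s sJ]|]|i]; case: g => [[[t tJ]|]|i'] //=.
- move=> /and3P[_ sj /forallP Hs] /and3P[_ tj /forallP Ht].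
  congr (inl (Some _)); apply/val_inj/val_inj => /=.
  have := Hs t; have := Ht s; rewrite sJ tJ sj tj /=; lia.
- move=> /and3P[_ sj _] /andP[_ /forallP/(_ s)]; rewrite sJ /=; lia.
- move=> /and3P[H _ _] /andP[c2 /eqP ji]; move: H; rewrite c2 ji /=.
  have := ltn_ord i'; lia.
- move=> /andP[_ /forallP/(_ t)]; rewrite tJ /= => H /and3P[_ tj _]; lia.
- move=> /andP[H _] /andP[c2 /eqP ji]; move: H; rewrite c2 ji /=.
  have := ltn_ord i'; lia.
- move=> /andP[c2 /eqP ji] /and3P[H _ _]; move: H; rewrite c2 ji /=.
  have := ltn_ord i; lia.
- move=> /andP[c2 /eqP ji] /andP[H _]; move: H; rewrite c2 ji /=.
  have := ltn_ord i; lia.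
by move=> /andP[_ /eqP->] /andP[_ /eqP[ii]]; congr inr; apply/val_inj.
Qed.

Lemma level_class_cut (s : {s : 'I_p | s \notin J}) c :
  c != 2%:R -> level_class (inl (Some s)) c (val s) = false /\
               level_class (inl (Some s)) c (val s).+1 = true.
Proof.
move=> /negPf c2; rewrite /= c2 /= ltnn ltnSn /=; split=> //.
by apply/forallP=> t; apply/implyP=> /andP[_]; rewrite ltnS.
Qed.

(** The classes number [p - #|J|] for the rows outside [J], one for the top circle and [p.-1] for
    the right column; flipping any of them preserves the mirror symmetry. *)
Lemma sum_sym_dvd z : exists a,
  \sum_(k | labelling (paired J) k && mirror_sym k) coord (paired J) k z =
  h ^+ (2 * p - #|J|) * a.
Proof.
have -> : (2 * p - #|J|)%N = #|{: option {s : 'I_p | s \notin J} + 'I_p.-1}|.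
  rewrite card_sum card_option card_sig card_ord.
  have := cardsC J; rewrite card_ord.
  have -> : #|[pred s | s \notin J]| = #|~: J| by apply: eq_card => s; rewrite !inE.
  lia.
apply: (dvd_sum_coord (K := fun f => level_lab (level_class f) (level_class f))).
- exact: level_classP.
- case=> [[s|]|i].
  + exists ((0, val s), 2%:R); rewrite level_labE [(_ + _)%N]addn1.
    by have [_ ->] := @level_class_cut s 0 isT.
  + exists ((0, top), 0); rewrite level_labE /=.
    by apply/forallP=> t; rewrite implybT.
  + exists ((2%:R, row i), 2%:R); rewrite level_labE /=.
    by rewrite val_row ?addn1 ?eqxx //; have := ltn_ord i; lia.
- by move=> f g d; rewrite !level_labE; apply: level_class_disjoint.
move=> f k _ sk; apply: mirror_sym_add sk _; apply: mirror_sym_level_lab => j;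
  by case: f => [[s|]|i].
Qed.

End Flip.

(* If no row of the left and central columns is cut, then the two nested circles
   inl true and inl false play the role of the level classes. *)
Definition side_class (f : bool + 'I_p.-1) (east_side : bool) c j : bool :=
  match f with
  | inl b => if c == 0 then b (+) east_side else if c == 1 then ~~ b (+) east_side
             else b && ~~ (0 < j < p)%N
  | inr i => (c == 2%:R) && (j == i.+1)
  end.

Lemma side_classP f :
  labelling (paired setT) (level_lab (side_class f true) (side_class f false)).
Proof.
apply: level_labP; split=> c.
- by case: f => [b|i]; rewrite /= ?andbF //; elim/Z3_case: c; case: b.
- case: f => [b|i]; first by elim/Z3_case: c; case: b; rewrite //= ltnn andbF.
  by rewrite /= gtn_eqF ?andbF //; have := ltn_ord i; lia.
move=> r; rewrite cut_paired in_setT orbF.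
by case: f => [b|i]; elim/Z3_case: c.
Qed.

Lemma sum_sym_dvd_setT z : exists a,
  \sum_(k | labelling (paired setT) k &&
    mirror_sym k) coord (paired setT) k z = h ^+ p.+1 * a.
Proof.
have -> : p.+1 = #|{: bool + 'I_p.-1}|.
  by rewrite card_sum card_bool card_ord; lia.
apply: (dvd_sum_coord (K := fun f =>
  level_lab (side_class f true) (side_class f false))).
- exact: side_classP.
- case=> [b|i]; last first.
    exists ((2%:R, row i), 2%:R); rewrite ffunE /=.
    by rewrite val_row ?eqxx //; have := ltn_ord i; lia.
  by exists ((0, top), if b then 1 else 0); rewrite ffunE; case: b.
- move=> f g [[c r] i]; rewrite !ffunE.
  have rp := ltn_ord r.
  case: f => [b|j]; case: g => [b'|j'] /=.
  + by elim/Z4P: i; elim/Z3_case: c; case: b; case: b' => //=; rewrite ?andbF.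
  + by have := ltn_ord j'; elim/Z4P: i; elim/Z3_case: c; case: b => //=; lia.
  + by have := ltn_ord j; elim/Z4P: i; elim/Z3_case: c; case: b' => //=; lia.
  + have := @val_inj _ _ _ j j'; elim/Z4P:
    i => /= H /andP[_ /eqP Ej] /andP[_ /eqP Ej'];
    by congr inr; apply: H; apply: succn_inj; rewrite -Ej -Ej'.
move=> f k _ sk; apply: mirror_sym_add sk _; apply: mirror_sym_level_lab => j;
  by case: f => [[]|i].
Qed.

(* 2p minus the number of classes of level_class, resp. side_class. *)
Definition paired_exp J : nat := minn #|J| p.-1.

Lemma sum_sym_dvd_exp J z : exists a, h ^+ paired_exp J *
  \sum_(k | labelling (paired J) k &&
    mirror_sym k) coord (paired J) k z = h ^+ (2 * p) * a.
Proof.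
have Jp : (#|J| <= p)%N by have := max_card (mem J); rewrite card_ord.
have [->|nJ] := eqVneq J setT.
  have [a ->] := sum_sym_dvd_setT z; exists a; rewrite mulrA -exprD.
  by rewrite /paired_exp cardsT card_ord; congr (_ ^+ _ * _); lia.
have Jp' : (#|J| < p)%N.
  by have := proper_card (A := J) (B := setT); rewrite properT cardsT card_ord;
    apply.
have [a ->] := sum_sym_dvd J z; exists a; rewrite mulrA -exprD.
by rewrite /paired_exp; congr (_ ^+ _ * _); lia.
Qed.

Definition phi_under (z : CKh K) : R := \sum_(J : {set 'I_p})
  h ^+ paired_exp J * \sum_(k | labelling (paired J) k &&
    mirror_sym k) coord (paired J) k z.

Lemma phi_underZ (a : R) z : phi_under (a *: z) = a * phi_under z.
Proof.
rewrite mulr_sumr; apply: eq_bigr => J _; rewrite mulrCA; congr (_ * _).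
by rewrite mulr_sumr; apply: eq_bigr => k _; rewrite coordZ.
Qed.

Lemma phi_underB z z' : phi_under (z - z') = phi_under z - phi_under z'.
Proof.
rewrite opprR -big_split; apply: eq_bigr => J _ /=; rewrite -mulrDr; congr (_ * _).
by rewrite -big_split; apply: eq_bigr => k _; rewrite coordD coordN.
Qed.

Lemma phi_under_dvd z : exists a, phi_under z = h ^+ (2 * p) * a.
Proof. by apply: dvd_sum => J; apply: sum_sym_dvd_exp. Qed.

(** The resolutions for [J] and for [J] with [r] added have a common predecessor, from which one is
    reached through the central column and the other through the left one. Their contributions will
    cancel. *)
Lemma subc_paired J r : r \notin J ->
  subc (paired (r |: J)) (0, r) = subc (paired J) (1, r).
Proof.
move=> rJ; apply/ffunP=> -[c s]; rewrite !ffunE /= !xpair_eqE !inE.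
elim/Z3_case: c => //=; last by rewrite negb_or.
by have [->|] := eqVneq s r; rewrite ?(negPf rJ).
Qed.

Lemma mirror_sym_const J J' c c' r k :
  (c == 0) && (c' == 1) || (c == 1) && (c' == 0) ->
  labelling (paired J) k -> mirror_sym k -> k ((c, r), 0) = k ((c, r), 2%:R) ->
  k ((c', r), 0) = k ((c', r), 2%:R).
Proof.
move=> cc kv /mirror_symP sk E; have C := labelling_const kv E.
have S i : k ((c', r), i) = k ((c, r), 1 - i).
  by case/orP: cc => /andP[/eqP-> /eqP->]; rewrite sk ?subKr.
by rewrite !S !C.
Qed.

Lemma labelling_subc (v : vertex K) x k : v x -> labelling v k ->
  k (x, 0) = k (x, 2%:R) -> labelling (subc v x) k.
Proof.
by move=> vx kv E; apply: (labelling_transfer (c := x) _ E kv) => b nb;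
  rewrite ffunE nb.
Qed.

Lemma labelling_addc (v : vertex K) x k : v x -> labelling (subc v x) k ->
  k (x, 0) = k (x, 2%:R) -> labelling v k.
Proof.
by move=> vx kv E; apply: (labelling_transfer (c := x) _ E kv) => b nb;
  rewrite ffunE nb.
Qed.

Definition paired_term z J (x : pcrossing p) : R := h ^+ paired_exp J *
  \sum_(k | labelling (paired J) k && mirror_sym k)
    (k (x, 0) == k (x, 2%:R))%:R * edge_coef (subc (paired J) x) x *
    coord (subc (paired J) x) k z.

Lemma paired_termE z J x : paired_term z J x =
  h ^+ paired_exp J * edge_coef (subc (paired J) x) x *
  \sum_(k | (labelling (paired J) k && mirror_sym k) && (k (x, 0) == k (x, 2%:R)))
    coord (subc (paired J) x) k z.
Proof.
rewrite /paired_term -mulrA [X in _ = _ * X]mulr_sumr; congr (_ * _).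
rewrite [RHS]big_mkcondr; apply: eq_bigr => k _.
by case: eqP; rewrite ?mul1r // !mul0r.
Qed.

Lemma edge_coef_center J r : r \notin J ->
  edge_coef (subc (paired J) (1, r)) (1, r) = h.
Proof.
move=> rJ; have v1 : paired J (1, r) by rewrite ffunE /= rJ.
pose s : {s : 'I_p | s \notin J} := exist _ r rJ.
apply: (edge_coef_split pretzel_edge_odd (k :=
  level_lab (level_class (inl (Some s))) (level_class (inl (Some s))))).
- by rewrite ffunE eqxx.
- by rewrite subcK //; apply: level_classP.
have [A B] := @level_class_cut J s 1 isT.
by rewrite !ffunE [val _]/= [level_class _ _ _]A [level_class _ _ _]B.
Qed.

(** The weights are made for this balance. The left edge is a merge, compensated by one more power
    of [h], except when the new set is all rows; then it is a split and the [minn] in [paired_exp]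
    stops the growth. *)
Lemma edge_coef_left J r : r \notin J -> h ^+ paired_exp J * h =
  h ^+ paired_exp (r |: J) * edge_coef (subc (paired J) (1, r)) (0, r).
Proof.
move=> rJ; rewrite /paired_exp cardsU1 rJ add1n.
have v0 : paired (r |: J) (0, r) by rewrite ffunE /= setU11.
have [full|/eqP nfull] := (r |: J =P setT).
  have cJ : #|J|.+1 = p by rewrite -add1n -[1%N]/(nat_of_bool true) -rJ -cardsU1
    full cardsT card_ord.
  have -> : edge_coef (subc (paired J) (1, r)) (0, r) = h.
    rewrite -subc_paired //; apply: (edge_coef_split pretzel_edge_odd
      (k := level_lab (side_class (inl true) true) (side_class (inl true) false))).
    - by rewrite ffunE eqxx.
    - by rewrite subcK // full; apply: side_classP.
    by rewrite !ffunE.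
  by congr (_ ^+ _ * _); lia.
have [s sJ] : exists s, s \notin r |: J.
  have /subsetPn[s _ sJ] : ~~ ([set: 'I_p] \subset r |: J) by rewrite subTset.
  by exists s.
move: sJ; rewrite !inE negb_or => /andP[sr sJ].
rewrite (@edge_coef_cut _ 0 r s) 1?eq_sym //.
- rewrite mulr1 -exprSr; congr (_ ^+ _).
  have := max_card (mem (s |: (r |: J))); rewrite card_ord.
  have -> : #|s |: (r |: J)| = #|J|.+2 by rewrite !cardsU1 !inE negb_or sr sJ rJ.
  lia.
- by rewrite /cut !ffunE /= (negPf rJ).
- by rewrite /cut !ffunE /= (negPf sJ) ?andbF.
Qed.

Lemma paired_term_eq z J r : r \notin J ->
  paired_term z J (1, r) = paired_term z (r |: J) (0, r).
Proof.
move=> rJ; rewrite (paired_termE z J) (paired_termE z (r |: J)) (subc_paired rJ).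
rewrite (edge_coef_center rJ) (edge_coef_left rJ); congr (_ * _).
have v1 : paired J (1, r) by rewrite ffunE /= rJ.
have v0 : paired (r |: J) (0, r) by rewrite ffunE /= setU11.
apply: eq_bigl => k; apply/andP/andP => -[/andP[kv sk] /eqP E].
  have E0 := @mirror_sym_const J J 1 0 r k isT kv sk E.
  rewrite sk E0 eqxx andbT; split=> //.
  by apply: (labelling_addc v0) E0; rewrite subc_paired //; apply: labelling_subc.
have E1 := @mirror_sym_const _ J 0 1 r k isT kv sk E.
rewrite sk E1 eqxx andbT; split=> //.
by apply: (labelling_addc v1) E1; rewrite -subc_paired //; apply: labelling_subc.
Qed.

Lemma sum_Z3 (f : 'Z_3 -> R) : \sum_c f c = f 0 + f 1 + f 2%:R.
Proof.
rewrite !big_ord_recl big_ord0 addr0 addrA.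
by congr (f _ + f _ + f _); apply/val_inj.
Qed.

(** Adding [r] to [J] matches the central terms, with [r] outside [J], with the left terms, with [r]
    inside; matched terms are equal and cancel in characteristic 2. The right column, being cut by
    0-smoothings, has no incoming edges. *)
Lemma phi_under_d z : phi_under (dKh z) = 0.
Proof.
have E J : h ^+ paired_exp J *
    \sum_(k | labelling (paired J) k && mirror_sym k) coord (paired J) k (dKh z) =
    \sum_(r | r \in J) paired_term z J (0, r) +
      \sum_(r | r \notin J) paired_term z J (1, r).
  rewrite (eq_bigr (fun k => \sum_(x | paired J x) (k (x, 0) == k (x, 2%:R))%:R *
     edge_coef (subc (paired J) x) x * coord (subc (paired J) x) k z)); last first.
    by move=> k /andP[kv _]; rewrite (coord_d pretzel_edge_odd).
  rewrite exchange_big /= mulr_sumr big_mkcond.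
  rewrite (eq_bigr (fun x : pcrossing p =>
    if paired J (x.1, x.2) then paired_term z J (x.1, x.2) else 0)); last first.
    by case.
  rewrite -(pair_bigA _ (fun c r => if paired J (c, r) then paired_term z J (c,
    r) else 0)) sum_Z3.
  rewrite [X in _ + X]big1 => [|r _]; last by rewrite ffunE.
  by rewrite addr0; congr (_ + _); rewrite [RHS]big_mkcond;
    apply: eq_bigr => r _; rewrite ffunE.
have E2 : \sum_(J : {set 'I_p}) \sum_(r | r \in J) paired_term z J (0, r) =
    \sum_(J : {set 'I_p}) \sum_(r | r \notin J) paired_term z J (1, r).
  transitivity (\sum_r \sum_(J : {set 'I_p} | r \in J) paired_term z J (0, r)).
    exact: exchange_big_dep.
  transitivity (\sum_r \sum_(J : {set 'I_p} | r \notin J) paired_term z J (1,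
    r)); last first.
    exact: exchange_big_dep.
  apply: eq_bigr => r _.
  rewrite [LHS](reindex_onto (fun J => r |: J) (fun J => J :\ r)).
    apply: eq_big => J.
      rewrite setU11; apply/eqP/idP => [<-|]; first by rewrite !inE eqxx.
      exact: setU1K.
    by case/andP=> _ /eqP E2; rewrite [RHS]paired_term_eq // -E2 !inE eqxx.
  by move=> J rJ; rewrite setD1K.
apply: etrans (eq_bigr _ (fun J _ => E J)) _; rewrite big_split.
by apply: etrans (congr1 (fun x => x + _) E2) _; apply: addRR.
Qed.

(** Only the empty [J] gives the Seifert resolution, where the Lee colouring is mirror symmetric. *)
Lemma phi_under_lee : phi_under (lee K) = h ^+ (p.-1 + 2 * p).
Proof.
have v0 : paired set0 = seifert K.
  rewrite seifertE; apply/ffunP=> -[c r]; rewrite ffunE [RHS]ffunE /= !inE.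
  by elim/Z3_case: c.
have E J k : labelling (paired J) k -> J != set0 -> coord (paired J) k (lee K) = 0.
  move=> kv J0; rewrite coord_lee //; case: eqP => [E|]; last by rewrite mul0r.
  case/eqP: J0; apply/setP=> r; rewrite in_set0; apply/negbTE.
  have := congr1 (fun v : vertex K => v (1, r)) E.
  by rewrite -v0 !ffunE /= in_set0 => ->.
transitivity (h ^+ paired_exp set0 *
  \sum_(k | labelling (paired set0) k &&
    mirror_sym k) coord (paired set0) k (lee K)).
  apply: big_only1 => // J J0 _.
  by rewrite big1 ?mulr0 // => k /andP[kv _]; apply: E.
rewrite v0 sum_coord_lee //.
  by rewrite /paired_exp cards0 min0n mul1r; congr (_ ^+ _); lia.
by apply/mirror_symP=> r i; rewrite !ffunE /lam; elim/Z4P: i.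
Qed.

Lemma under_bound n : divisible (@dKhI K) n (lee_under K) -> (n <= p.-1)%N.
Proof.
apply: (@divisible_bound _ _ (fun z : CKhI K => phi_under z.1) _ _ _ (2 * p)).
- by move=> a z; apply: phi_underZ.
- by move=> x y; apply: phi_underB.
- by move=> z; apply: phi_under_d.
- by move=> z; apply: phi_under_dvd.
exact: phi_under_lee.
Qed.

(** * Invariance of the Lee cycle and the two values of d_h *)

Lemma supported_lee : supported false false None
  (fun k => h ^+ (3 * p).-1 * [forall d, k d == leeX d]%:R) (lee K).
Proof. by move=> v k kv; rewrite coord_lee // ncirclesE // seifertE. Qed.

(** The two sides of each crossing lie on consecutive levels and so have opposite Lee colours. *)
Lemma dKh_lee : dKh (lee K) = 0.
Proof.
apply: coord_inj0 => v k kv; rewrite (coord_d_at pretzel_edge_odd supported_lee kv).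
apply: big1 => -[c r] _; case: eqP => [E|]; last by rewrite mul0r.
rewrite (_ : [forall d, _] = false) ?mulr0 //; apply: contra_eqF E => /forallP H.
rewrite !(eqP (H _)) !leeX_lam /lam /= addn0 addn1 /=.
by case: (odd r).
Qed.

Lemma tauKh_lee : tauKh (lee K) = lee K.
Proof.
apply: (supported_inj (supported_tau supported_lee) supported_lee) => k _ /=;
  congr (_ * (nat_of_bool _)%:R).
have lt (d : dart K) : lam (si_tau d) = lam d.
  by case: d => -[c r] i; rewrite /lam; elim/Z4P: i.
apply/forallP/forallP => H d; rewrite leeX_lam.
  by have := H (@si_tau K d); rewrite ffunE si_tauK leeX_lam lt.
by rewrite ffunE -(lt d) -leeX_lam.
Qed.

Lemma under_dh : is_dh (@dKhI K) (lee_under K) p.-1.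
Proof.
split; last exact: under_bound.
  by apply: dKhI_cycle; rewrite ?dKh_lee ?dKh0 ?tauKh_lee ?subrr.
have [w [b [Hw leeE bt]]] := @lee_under_exact.
(* Since w and [b] are invariant under the involution, the second components can be taken to be
   0. *)
apply: (@dKhI_divisible _ _ _ _ w 0 b 0) => //.
- exact: (seifert_cycle_d Hw).
- by rewrite (seifert_cycle_tau Hw) dKh0 !subrr.
by rewrite scaler0 add0r bt dKh0 !subrr.
Qed.

Lemma over_dh : is_dh (@dKhI K) (lee_over K) p.
Proof.
split; last exact: over_bound.
  by apply: dKhI_cycle; rewrite ?dKh_lee ?dKh0 ?tauKh0 ?subrr.
have [g [u [e [b [dg gu de leeE]]]]] := @lee_over_exact.
apply: (@dKhI_divisible _ _ _ _ g u e b) => //.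
  by rewrite de CKh_addrr.
by rewrite leeE -[LHS]addrA.
Qed.

End Pretzel.

Theorem theorem4 (p : nat) (p_odd : odd p) (p_ge3 : (3 <= p)%N) :
  s_under (pretzel (odd_gt0 p_odd)) 0%R /\ s_over (pretzel (odd_gt0 p_odd)) 2%R.
Proof.
split.
  by exists p.-1; [apply: under_dh | rewrite rasmussenE // subrr].
exists p; first exact: over_dh.
rewrite rasmussenE //; lia.
Qed.
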